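(* Let $a \in A \setminus R$ be a homogeneous element of smallest degree. Then the following are equivalent: (a) $\deg \Delta_{A/R} = (p-1)\deg a$. (b) $\Delta_{A/R} = \lambda\, \mathrm{Tr}_{F/K}(a^{p-1})$ for some $\lambda \in \Bbbk^\times$. (c) $R$ is a direct summand of $A$.
   Context: Let $p$ be a prime, $\Bbbk$ a field of characteristic $p$, $S=\Bbbk[x_1,\ldots,x_n]$ with $\deg x_i=1$, and let $G\subseteq \mathrm{GL}_n(\Bbbk)$ be a finite $p$-group acting on $S$ by degree-preserving $\Bbbk$-algebra automorphisms. A pseudo-reflection in $G$ is an element $\tau$ such that $\{l\in S_1 \mid \tau l=l\}$ has dimension $n-1$ over $\Bbbk$; every pseudo-reflection in the $p$-group $G$ is a transvection. Let $\mathcal P$ be the set of transvections in $G$. Assume that $G$ is generated by $\mathcal P$ and that for all $g\in G$, $gx_1=x_1$ and $gx_i-x_i\in \Bbbk\langle x_1,\ldots,x_{i-1}\rangle$ (the $\Bbbk$-span) for $2\le i\le n$. For $g\in\mathcal P$ let $\beta_g$ be the largest $j$ such that $x_j$ appears with non-zero coefficient in $gx_i-x_i$ for some $i$. For a subgroup $N$ of $G$ generated by transvections let $\beta_N=\max\{\beta_g\mid g\in \mathcal P\cap N\}$ (read as $0$ if $N$ is trivial). The group $G$ has a composition series $0=G_0\subsetneq G_1\subsetneq\cdots\subsetneq G_k=G$ such that for each $1\le i\le k$: $G_i$ is generated by transvections; $G_i/G_{i-1}\simeq \mathbb Z/p\mathbb Z$ is generated by the class of a transvection; and $\beta_{G_i}\ge\beta_{G_{i-1}}$.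 Let $G'=G_{k-1}$ for such a series, with $\beta_\tau\ge\beta_{G'}$ for all $\tau\in\mathcal P\setminus G'$. Thus $G'$ is normal in $G$, generated by transvections, and $G/G'\simeq\mathbb Z/p\mathbb Z$ is generated by the class of a transvection $\sigma\in G\setminus G'$. Write $R=S^G$, $A=S^{G'}$, $K=\mathrm{Frac}(R)$, $F=\mathrm{Frac}(A)$, and $\mathrm{Tr}_{F/K}$ for the field trace. The Dedekind different of $A/R$ is the ideal $\mathscr D_D(A/R)=\{x\in F\mid x\cdot C\subseteq A\}$ of $A$, where $C=\{y\in F\mid \mathrm{Tr}_{F/K}(yA)\subseteq R\}$ is the inverse different. It is a homogeneous principal ideal of the UFD $A$; $\Delta_{A/R}$ denotes a fixed homogeneous generator of it. ''$R$ is a direct summand of $A$'' means that there is an $R$-module map $f:A\to R$ with $f(r)=r$ for all $r\in R$. *)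

(* Defs.v *)
From HB Require Import structures.
From mathcomp Require Import all_boot all_order all_fingroup all_algebra.
From mathcomp Require Import all_solvable all_character.
From mathcomp Require Import mpoly.

Set Implicit Arguments.
Unset Strict Implicit.
Unset Printing Implicit Defensive.

Import GRing.Theory.
Local Open Scope ring_scope.

Section FractionFields.

Variable D : idomainType.
Implicit Type B : {pred D}.

Definition in_frac B (x : {fraction D}) : Prop :=
  exists u v, [/\ u \in B, v \in B, v != 0 & x = tofrac u / tofrac v].

End FractionFields.

Section FieldTrace.

(* K and F are subfields of the ambient field L, with F finite over K. *)
Variables (L : fieldType) (K F : L -> Prop).

Definition is_basis m (e : 'I_m -> L) : Prop :=
  [/\ forall i, F (e i),
      forall c : 'I_m -> L, (forall i, K (c i)) ->
        \sum_i c i * e i = 0 -> forall i, c i = 0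
    & forall x, F x -> exists2 c : 'I_m -> L,
        forall i, K (c i) & x = \sum_i c i * e i].

(* [is_trace y t] reads "t = Tr_{F/K}(y)": t is the trace of the matrix M of
   the K-linear endomorphism x |-> y * x of F in some K-basis of F. *)
Definition is_trace (y t : L) : Prop :=
  exists m (e : 'I_m -> L) (M : 'M[L]_m),
    [/\ is_basis e, forall i j, K (M i j),
        forall j, y * e j = \sum_i M i j * e i
      & t = \tr M].

End FieldTrace.

Section Different.

Variables (D : idomainType) (R A : {pred D}).

Definition inverse_different (y : {fraction D}) : Prop :=
  in_frac A y /\
  forall b, b \in A -> exists2 r, r \in R &
    is_trace (in_frac R) (in_frac A) (y * tofrac b) (tofrac r).

Definition dedekind_different (x : {fraction D}) : Prop :=
  in_frac A x /\
  forall y, inverse_different y -> exists2 b, b \in A & x * y = tofrac b.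

Definition generates_different (d : D) : Prop :=
  d \in A /\
  forall x, dedekind_different x <->
            exists2 b, b \in A & x = tofrac (d * b).

(* Only the values of f on A matter. *)
Definition direct_summand : Prop :=
  exists f : D -> D,
    [/\ {in A, forall x, f x \in R},
        {in A &, forall x y, f (x + y) = f x + f y},
        {in R & A, forall r x, f (r * x) = r * f x}
      & {in R, forall r, f r = r}].

End Different.

Section Action.

Variables (k : fieldType) (n : nat) (gT : finGroupType) (G : {group gT}).
Variable rG : mx_representation k G n.
Implicit Types (g : gT) (q : {mpoly k[n]}) (N : {set gT}).

(* The left action on S: column i of the matrix of g gives the image of x_i. *)
Definition poly_act g q : {mpoly k[n]} :=
  q \mPo [tuple \sum_(j < n) rG g j i *: 'X_j | i < n].

Definition invariants N : {pred {mpoly k[n]}} :=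
  [pred q | [forall g in N, poly_act g q == q]].

(* A linear form \sum_i v_i x_i, encoded as the row vector v, is fixed by g
   iff v *m (rG g)^T = v.  As #|G| is a power of the characteristic, the
   pseudo-reflections in G are its transvections. *)
Definition pseudo_reflection g : bool :=
  (\rank (eigenspace (rG g)^T 1)).+1 == n.

Definition transvections : {set gT} := [set g in G | pseudo_reflection g].

Definition triangular : Prop :=
  forall g, g \in G -> forall i : 'I_n, exists c : 'I_n -> k,
    poly_act g 'X_i - 'X_i = \sum_(j < n | (j < i)%N) c j *: 'X_j.

(* Variables are counted from 1, hence j.+1. *)
Definition beta_elt g : nat :=
  \max_(j < n | [exists i : 'I_n, (poly_act g 'X_i - 'X_i)@_(U_(j)) != 0]) j.+1.

Definition beta N : nat := \max_(g in transvections :&: N) beta_elt g.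

Definition transvection_generated (N : {group gT}) : Prop :=
  <<transvections :&: N>>%g = N.

Definition transvection_series (p m : nat) (H : nat -> {group gT}) : Prop :=
  [/\ H 0%N = 1%G, H m = G
    & forall i, (i < m)%N ->
      [/\ H i \proper H i.+1 /\ (H i <| H i.+1)%g,
          transvection_generated (H i.+1),
          (H i.+1 / H i)%g \isog Zp p,
          exists2 t, t \in transvections :&: H i.+1 &
            (H i.+1 / H i)%g = <[coset (H i) t]>%g
        & (beta (H i) <= beta (H i.+1))%N]].

Definition penultimate_subgroup (p : nat) (G' : {group gT}) : Prop :=
  (exists m H, transvection_series p m.+1 H /\ H m = G') /\
  (forall t, t \in transvections :\: G' -> (beta G' <= beta_elt t)%N).

End Action.

Section Degree.

Variables (k : fieldType) (n : nat).

(* Total degree; only used for nonzero polynomials (mdegree 0 = 0). *)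
Definition mdegree (q : {mpoly k[n]}) : nat := (msize q).-1.

Definition smallest_homog_outside (R A : {pred {mpoly k[n]}})
    (a : {mpoly k[n]}) : Prop :=
  [/\ a \in A, a \notin R, a \is homog mdeg
    & forall b, b \in A -> b \notin R -> b \is homog mdeg ->
        (mdegree a <= mdegree b)%N].

End Degree.

(* Main.v *)
Require Import Defs.
From HB Require Import structures.
From mathcomp Require Import all_boot all_order all_fingroup all_algebra.
From mathcomp Require Import all_solvable all_character.
From mathcomp Require Import mpoly.
From mathcomp Require Import ring.
From Stdlib Require Import Classical.

(* Let s represent a generator of G / G', let delta = s - 1 on A, and let d be
   the gcd of delta(A) in the polynomial ring S, a gcd domain.  As p-groups have
   no nontrivial characters in characteristic p, d lies in R, so delta / d maps
   A to A.  Since Tr = delta^(p-1), the element d^(-(p-1)) lies in the inverse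
   different C.  Conversely, if y is in C then y * prod_(0<i<p) (b_i - s^i b_i)
   is in A for all choices of b_i in A, and as each s^i - 1 has the same gcd d
   this gives y d^(p-1) in A.  Hence Delta is d^(p-1) up to a unit; moreover d
   divides delta(a), so deg d <= deg a.

   (a) => (b): Tr(a^j) is a multiple of d^(p-1) of degree j deg a, hence zero
   for j < p-1 and a scalar times d^(p-1) for j = p-1; not all of these vanish,
   since 1, a, ..., a^(p-1) is a K-basis of F.
   (b) => (c): b |-> Tr(a^(p-1) b) / Tr(a^(p-1)) maps A to R.
   (c) => (a): a retraction is Tr(y .) with y in C, and Tr y = 1.  Then
   t = y d^(p-1) is in A with delta^(p-1) t = d^(p-1), so that
   b = delta^(p-2) t / d^(p-2) is in A with delta b = d; a homogeneous component
   of b forces deg a <= deg d. *)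

Set Implicit Arguments.
Unset Strict Implicit.
Unset Printing Implicit Defensive.

Import GRing.Theory.
Local Open Scope ring_scope.

(** * Greatest common divisors *)

Section Divisibility.

Variable D : idomainType.
Implicit Types x y z d s t : D.

Definition divides x y : Prop := exists z, y = z * x.

Lemma divides_refl x : divides x x.
Proof. by exists 1; rewrite mul1r. Qed.

Lemma divides0 x : divides x 0.
Proof. by exists 0; rewrite mul0r. Qed.

Lemma divides_trans x y z : divides x y -> divides y z -> divides x z.
Proof. by move=> [u ->] [v ->]; exists (v * u); rewrite mulrA. Qed.

Lemma divides_mull x y z : divides x y -> divides x (z * y).
Proof. by move=> [u ->]; exists (z * u); rewrite mulrA. Qed.

Lemma divides_mulr x y z : divides x y -> divides x (y * z).
Proof. by rewrite mulrC; apply: divides_mull. Qed.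

Lemma divides_add x y z : divides x y -> divides x z -> divides x (y + z).
Proof. by move=> [u ->] [v ->]; exists (u + v); rewrite mulrDl. Qed.

Lemma divides_sub x y z : divides x y -> divides x z -> divides x (y - z).
Proof. by move=> [u ->] [v ->]; exists (u - v); rewrite mulrBl. Qed.

Lemma divides_sum (I : Type) (r : seq I) (P : pred I) (F : I -> D) x :
  (forall i, P i -> divides x (F i)) -> divides x (\sum_(i <- r | P i) F i).
Proof.
by move=> xF; elim/big_ind: _ => //; [apply: divides0 | apply: divides_add].
Qed.

Lemma divides_pmul2l c x y : c != 0 -> divides (c * x) (c * y) -> divides x y.
Proof. by move=> nz_c [z]; rewrite mulrCA => /(mulfI nz_c) ->; exists z. Qed.

Lemma divides_mul2l c x y : divides x y -> divides (c * x) (c * y).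
Proof. by move=> [z ->]; exists z; rewrite mulrCA. Qed.

Lemma divides_antisym x y :
  x != 0 -> divides x y -> divides y x -> exists2 u, divides u 1 & y = u * x.
Proof.
move=> nz_x [u ->] [v]; rewrite mulrA -[LHS]mul1r => /(mulIf nz_x) uv1.
by exists u => //; exists v.
Qed.

(* A scale-invariant greatest common divisor: the gcd of [s * X] is [s * d],
   in particular (s = 1) [d] is an ordinary gcd of [X]. *)
Definition gcd_of (X : D -> Prop) d : Prop :=
  (forall x, X x -> divides d x) /\
  (forall s t, (forall x, X x -> divides t (s * x)) -> divides t (s * d)).

Definition gcd_domain : Prop :=
  forall x y, exists d, gcd_of (fun z => z = x \/ z = y) d.

Lemma gcd_of_seq (r : seq D) :
  gcd_domain -> exists d, gcd_of (fun z => z \in r) d.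
Proof.
move=> gcdD; elim: r => [|x r [d [d_r r_d]]].
  by exists 0; split=> // s t _; rewrite mulr0; apply: divides0.
have [e [e_xd xd_e]] := gcdD x d; exists e; split=> [z | s t t_xr].
  rewrite inE => /predU1P[-> | /d_r d_z]; first by apply: e_xd; left.
  by apply: divides_trans d_z; apply: e_xd; right.
apply: xd_e => z [-> | ->]; first by apply: t_xr; rewrite mem_head.
by apply: r_d => w r_w; apply: t_xr; rewrite inE r_w orbT.
Qed.

(* The gcd of a possibly infinite family is an element of minimal norm among
   the [g] such that every common divisor of [s * X] divides [s * g]. *)
Lemma gcd_of_pred (norm : D -> nat) (X : D -> Prop) x0 :
    (forall x y, y != 0 -> divides x y ->
       (norm x <= norm y)%N /\ (norm x = norm y -> divides y x)) ->
    gcd_domain -> X x0 -> x0 != 0 ->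
  exists2 d, d != 0 & gcd_of X d.
Proof.
move=> normP gcdD Xx0 nz_x0.
pose bound g := forall s t,
  (forall x, X x -> divides t (s * x)) -> divides t (s * g).
have: bound x0 by move=> s t; apply.
have [m] := ubnP (norm x0); move: (x0) nz_x0.
elim: m => // m IHm g nz_g lt_gm g_bound.
have [g_X | not_gX] := classic (forall x, X x -> divides g x);
  first by exists g.
have [x [Xx not_gx]] : exists x, X x /\ ~ divides g x.
  apply: NNPP => nex; apply: not_gX => x Xx.
  by apply: NNPP => not_gx; apply: nex; exists x.
have [e [e_gx gx_e]] := gcdD g x.
have e_g : divides e g by apply: e_gx; left.
have [le_eg eq_eg] := normP _ _ nz_g e_g.
apply: (IHm e).
- by apply: contraNneq nz_g => e0; move: e_g; rewrite e0 => -[z ->];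
    rewrite mulr0.
- rewrite -ltnS (leq_trans _ lt_gm) // ltnS ltn_neqAle le_eg andbT.
  apply/eqP => /eq_eg g_e; apply: not_gx; apply: divides_trans g_e _.
  by apply: e_gx; right.
- by move=> s t tX; apply: gx_e => z [->|->]; [apply: g_bound | apply: tX].
Qed.

End Divisibility.

(** * Univariate polynomials over a gcd domain *)

Section PolynomialGcd.

Variable D : idomainType.
Implicit Types (f g h q r : {poly D}) (s t c : D).

(** Content 1 in scale-invariant form: modulo every [t], the only constant that kills [f] is
    zero. *)
Definition primitive f : Prop :=
  forall s t, divides t%:P (s%:P * f) -> divides t s.

Lemma dividesC_coef t f : (forall i, divides t f`_i) <-> divides t%:P f.
Proof.
split=> [t_f | [g ->] i]; last by rewrite coefMC; exists g`_i.
rewrite -[f]coefK poly_def; apply: divides_sum => i _.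
by rewrite -mul_polyC; apply/divides_mulr; have [z ->] := t_f i;
   exists z%:P; rewrite polyCM.
Qed.

(* McCoy's theorem over [D / t]: if [f] kills a nonzero polynomial there,
   then it kills a nonzero constant. *)
Lemma primitive_divides t f h :
  primitive f -> divides t%:P (h * f) -> divides t%:P h.
Proof.
move=> prim_f.
have [m] := ubnP (size h); elim: m h => // m IHm h lt_hm t_hf.
(* Each coefficient of [h] then kills [f] modulo [t], so primitivity applies to it. *)
suffices t_fh i : divides t%:P ((f`_i)%:P * h).
  apply/dividesC_coef => l; apply: prim_f; apply/dividesC_coef => i.
  by rewrite coefCM mulrC -coefCM; move/dividesC_coef: (t_fh i); apply.
(* Descending induction on [i]: the coefficients of [f] above [i] already kill [h] modulo [t], hence
   so does the truncation [f1] of [f] to degrees at most [i]. *)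
have [N] := ubnP (size f - i); elim: N i => // N IHN i lt_iN.
have [le_fi | lt_if] := leqP (size f) i.
  by rewrite nth_default // mul0r; apply: divides0.
have [-> | nz_h] := eqVneq h 0; first by rewrite mulr0; apply: divides0.
pose f1 := \sum_(j < size f | (j <= i)%N) f`_j *: 'X^j.
have t_f1h : divides t%:P (f1 * h).
  have ->: f1 = f - \sum_(j < size f | ~~ (j <= i)%N) f`_j *: 'X^j.
    by rewrite -{1}[f]coefK poly_def (bigID (fun j : 'I__ => (j <= i)%N)) /=
      addrK.
  rewrite mulrBl mulrC; apply: divides_sub => //; rewrite mulr_suml.
  apply: divides_sum => j; rewrite -ltnNge => lt_ij.
  rewrite -mul_polyC mulrAC; apply/divides_mulr/IHN.
  by rewrite -ltnS; apply: leq_trans lt_iN; rewrite ltnS ltn_sub2l.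
have size_f1 : (size f1 <= i.+1)%N.
  apply: (big_ind (fun q : {poly D} => size q <= i.+1)%N) => [|q r le_q le_r|j
    le_ji].
  - by rewrite size_poly0.
  - by rewrite (leq_trans (size_polyD _ _)) // geq_max le_q.
  - by rewrite (leq_trans (size_scale_leq _ _)) // size_polyXn.
have f1_i : f1`_i = f`_i.
  rewrite coef_sum (bigD1 (Ordinal lt_if)) //= coefZ coefXn eqxx mulr1.
  rewrite big1 ?addr0 // => j /andP[_ neq_ji]; rewrite coefZ coefXn.
  by rewrite [i == _]eq_sym -[i]/(nat_of_ord (Ordinal lt_if)) val_eqE (negbTE
    neq_ji) mulr0.
(* This product is the coefficient of [f1 * h] in degree [i + (size h).-1]. *)
have t_lead : divides t (f`_i * lead_coef h).
  move/dividesC_coef/(_ (i + (size h).-1)%N): t_f1h; rewrite coefM.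
  have lt_i : (i < (i + (size h).-1).+1)%N by rewrite ltnS leq_addr.
  rewrite (bigD1 (Ordinal lt_i)) //= f1_i addKn big1 ?addr0 // => j neq_ji.
  have [lt_ij | lt_ji | eq_ij] := ltngtP i j.
  - by rewrite [f1`_j]nth_default ?mul0r // (leq_trans size_f1).
  - rewrite [h`_ _]nth_default ?mulr0 //.
    rewrite -[leqLHS]prednK ?size_poly_gt0 // ltn_subRL.
    by rewrite ltn_add2r.
  - by case/eqP: neq_ji; apply: val_inj.
(* The [i]-th coefficient of [f] times [h1] is shorter than [h] and still kills [f] modulo [t], so
   the outer induction shows that it vanishes modulo [t]. *)
pose h1 := h - lead_coef h *: 'X^((size h).-1).
have h_h1 : h = h1 + lead_coef h *: 'X^((size h).-1) by rewrite subrK.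
have t_top : divides t%:P ((f`_i)%:P * (lead_coef h *: 'X^((size h).-1))).
  rewrite -mul_polyC mulrA -polyCM; apply: divides_mulr.
  by have [z ->] := t_lead; exists z%:P; rewrite polyCM.
rewrite h_h1 mulrDr; apply: divides_add => //; apply: IHm.
  apply: (@leq_trans (size h)); last by rewrite -ltnS.
  apply: (@leq_ltn_trans (size h).-1); last by rewrite prednK // size_poly_gt0.
  apply/leq_sizeP => j le_hj; rewrite coefCM coefB coefZ coefXn.
  have [-> | neq_j] := eqVneq j (size h).-1; first by rewrite mulr1 subrr mulr0.
  rewrite mulr0 subr0 [h`_j]nth_default ?mulr0 // -[leqLHS]prednK
    ?size_poly_gt0 //.
  by rewrite ltn_neqAle eq_sym neq_j.
have ->: (f`_i)%:P * h1 * f =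
    (f`_i)%:P * (h * f) - (f`_i)%:P * (lead_coef h *: 'X^((size h).-1)) * f.
  by rewrite /h1 mulrBr mulrBl -(mulrA _ h).
by apply: divides_sub; [apply: divides_mull | apply: divides_mulr].
Qed.

Hypothesis gcdD : gcd_domain D.

(** [c] is the gcd of the coefficients; its scale invariance, after cancelling [c], is the
    primitivity of the quotient. *)
Lemma primitive_part f : exists c f0,
  f = c%:P * f0 /\ (f != 0 -> primitive f0).
Proof.
have [c [c_f f_c]] := gcd_of_seq (polyseq f) gcdD.
have cont s t : divides t%:P (s%:P * f) -> divides t (s * c).
  move=> /dividesC_coef t_sf; apply: f_c => _ /(nthP 0)[i _ <-].
  by rewrite -coefCM.
have /dividesC_coef[f0 f_f0] i : divides c f`_i.
  have [le_fi | lt_if] := leqP (size f) i; last by apply/c_f/mem_nth.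
  by rewrite nth_default //; apply: divides0.
exists c, f0; split=> //; first by rewrite mulrC.
move=> nz_f s t t_sf0; have nz_c : c != 0.
  by apply: contraNneq nz_f => c0; rewrite f_f0 c0 mulr0.
apply: (@divides_pmul2l _ c) => //; rewrite [c * s]mulrC; apply: cont.
rewrite f_f0 polyCM [f0 * _]mulrC mulrCA; exact: divides_mul2l.
Qed.

(** The Euclidean algorithm with pseudo-division: [r] and [c] are the primitive part and the content
    of the last nonzero remainder. *)
Lemma primitive_bezout f g : (f != 0) || (g != 0) -> exists r u v c,
  [/\ primitive r, c != 0, c%:P * r = u * f + v * g,
      divides r f & divides r g].
Proof.
have [m] := ubnP (size g); elim: m f g => // m IHm f g lt_gm nz_fg.
have [g0 | nz_g] := eqVneq g 0.
  rewrite g0 eqxx orbF in nz_fg *.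
  have [c [f0 [f_f0 /(_ nz_fg) prim]]] := primitive_part f.
  have nz_c : c != 0 by apply: contraNneq nz_fg => c0; rewrite f_f0 c0 mul0r.
  exists f0, 1, 0, c; split=> //; first by rewrite -f_f0 mul1r mul0r addr0.
    by exists c%:P.
  exact: divides0.
pose q := Pdiv.CommonRing.rdivp f g; pose w := Pdiv.CommonRing.rmodp f g.
pose e := lead_coef g ^+ Pdiv.CommonRing.rscalp f g.
have nz_e : e != 0 by rewrite expf_neq0 // lead_coef_eq0.
have fE : e%:P * f = q * g + w by rewrite mul_polyC;
  apply: Pdiv.ComRing.rdivp_eq.
have lt_w : (size w < m)%N.
  by rewrite -ltnS (leq_trans _ lt_gm) // ltnS;
    apply: Pdiv.CommonRing.ltn_rmodpN0.
have [|r [u [v [c [prim nz_c cE r_g r_w]]]]] := IHm g w lt_w;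
  first by rewrite nz_g.
exists r, (v * e%:P), (u - v * q), c; split=> //.
  by rewrite cE -mulrA fE; ring.
have [X eX] : divides r (e%:P * f).
  by rewrite fE; apply: divides_add => //; apply: divides_mull.
(* As [r] is primitive, the quotient [X] of [e * f] by [r] is a multiple of [e], which can then be
   cancelled. *)
have [|Y X_Y] := @primitive_divides e r X prim.
  by rewrite -eX; exists f; rewrite mulrC.
exists Y; apply: (@mulfI _ e%:P); first by rewrite polyC_eq0.
by rewrite eX X_Y; ring.
Qed.

(** The gcd is the common content [e] times the primitive gcd [r] over the fraction field. A common
    divisor [T] of [S * f] and [S * g] is split likewise: its primitive part [T0] is compared with
    [r] through the Bezout relation, its content [tau] with [e]. *)
Lemma poly_gcd_domain : gcd_domain {poly D}.
Proof.
move=> f g.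
have [/andP[/eqP-> /eqP->] | ] := boolP ((f == 0) && (g == 0)).
  exists 0; split=> [_ [->|->]|s t _]; try exact: divides0.
  by rewrite mulr0; apply: divides0.
rewrite negb_and => nz_fg.
have [r [u [v [c [prim nz_c cE [f1 fE] [g1 gE]]]]]] := primitive_bezout nz_fg.
have nz_r : r != 0.
  apply: contraTneq nz_fg => r0; rewrite negb_or !negbK.
  by rewrite fE gE r0 !mulr0 eqxx.
(* The content of [F] is the common content of [f] and [g]. *)
pose F := f + g * 'X^(size f).
have F_coef i : F`_i = if (i < size f)%N then f`_i else g`_(i - size f).
  rewrite coefD coefMXn; case: ifP => lt_if; first by rewrite addr0.
  by rewrite nth_default ?add0r // leqNgt lt_if.
have F_div t : divides t%:P F -> divides t%:P f /\ divides t%:P g.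
  move=> /dividesC_coef t_F; split; apply/dividesC_coef => i.
    have := t_F i; rewrite F_coef; case: ltnP => // le_fi _.
    by rewrite nth_default //; apply: divides0.
  by have := t_F (i + size f)%N; rewrite F_coef ltnNge leq_addl addnK.
have nz_F : F != 0.
  apply: contraTneq nz_fg => F0; rewrite negb_or !negbK.
  have [] := F_div 0; first by rewrite F0; apply: divides_refl.
  by move=> [? ->] [? ->]; rewrite !mulr0 eqxx.
have [e [F0 [FE /(_ nz_F) primF]]] := primitive_part F.
have [e_f e_g] : divides e%:P f /\ divides e%:P g.
  by apply: F_div; exists F0; rewrite mulrC.
have divides_part h h1 : h = h1 * r -> divides e%:P h -> divides (e%:P * r) h.
  move=> hE; rewrite hE => /(primitive_divides prim)[h2 ->].
  by rewrite -mulrA; exists h2.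
exists (e%:P * r); split=> [_ [-> | ->] | S T TS].
- exact: divides_part fE _.
- exact: divides_part gE _.
have T_f : divides T (S * f) by apply: TS; left.
have T_g : divides T (S * g) by apply: TS; right.
have [-> | nz_S] := eqVneq S 0; first by rewrite mul0r; apply: divides0.
have nz_T : T != 0.
  apply: contraTneq nz_fg => T0; rewrite negb_or !negbK.
  move: T_f T_g; rewrite T0 => -[x /esym/eqP] xE [y /esym/eqP].
  by move: xE; rewrite !mulr0 ![0 == _]eq_sym !mulf_eq0 !(negbTE nz_S) => /= ->
    ->.
have [tau [T0 [TE /(_ nz_T) primT]]] := primitive_part T.
have T0_T : divides T0 T by rewrite TE; exists tau%:P.
have [X XE] : divides T0 (c%:P * (S * r)).
  apply: divides_trans T0_T _.
  have ->: c%:P * (S * r) = u * (S * f) + v * (S * g).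
    by rewrite mulrCA cE; ring.
  by apply: divides_add; apply: divides_mull.
(* [T0] divides [c * S * r], and [c] cancels because [T0] is primitive. With [Y] the quotient of
   [S * r] by [T0], it remains to see that [tau] divides [Y * e]. *)
have [|Y XY] := @primitive_divides c T0 X primT.
  by rewrite -XE; exists (S * r); rewrite mulrC.
have SrE : S * r = T0 * Y.
  apply: (@mulfI _ c%:P); first by rewrite polyC_eq0.
  by rewrite XE XY; ring.
have nz_T0 : T0 != 0 by apply: contraNneq nz_T => T00; rewrite TE T00 mulr0.
have tauY h h1 : h = h1 * r -> divides T (S * h) -> divides tau%:P (Y * h).
  move=> hE; rewrite hE => T_h.
  have: divides tau%:P (Y * h1).
    apply: (@divides_pmul2l _ T0) => //; rewrite [T0 * _]mulrC -TE.
    suff <-: S * (h1 * r) = T0 * (Y * h1) by [].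
    by rewrite mulrCA SrE; ring.
  by rewrite mulrA; apply: divides_mulr.
have: divides tau%:P (Y * e%:P).
  apply: (@primitive_divides _ F0) => //.
  rewrite -mulrA -FE mulrDr mulrA; apply: divides_add; first exact: tauY fE _.
  by apply: divides_mulr; apply: tauY gE _.
rewrite mulrCA SrE TE => tau_Ye.
have ->: e%:P * (T0 * Y) = T0 * (Y * e%:P) by ring.
by rewrite mulrC; apply: divides_mul2l.
Qed.

End PolynomialGcd.

(** * Multivariate polynomials over a field *)

Section MpolyGcd.

Variable k : fieldType.

Lemma muni_mwiden n (q : {mpoly k[n]}) : muni (mwiden q) = q%:P.
Proof.
elim/mpolyind: q => [|c m q _ _ IHq]; first by rewrite !raddf0.
rewrite !raddfD /= IHq mwidenZ muniZ; congr (_ + _).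
rewrite mwidenX muniE msuppX big_seq1 mcoeffX eqxx scale1r.
rewrite mnmwiden_ordmax expr0 alg_polyC -mul_polyC -polyCM mul_mpolyC.
congr (_ *: _)%:P; rewrite (_ : [multinom _ | _ < _] = m) //; apply/mnmP => i.
by rewrite mnmE mnmwiden_widen.
Qed.

Lemma muni_ord_max n : muni ('X_ord_max : {mpoly k[n.+1]}) = 'X.
Proof.
rewrite muniE msuppX big_seq1 mcoeffX eqxx scale1r mnm1E eqxx expr1.
rewrite (_ : [multinom _ | _ < _] = 0%MM) ?mpolyX0 ?scale1r //.
apply/mnmP => i; rewrite mnmE mnm1E mnm0E eq_sym.
by rewrite -val_eqE /= ltn_eqF.
Qed.

Lemma muni_surj n (P : {poly {mpoly k[n]}}) : exists q, muni q = P.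
Proof.
exists (\sum_(i < size P) mwiden P`_i * 'X_ord_max ^+ i).
rewrite raddf_sum -[RHS]coefK poly_def; apply: eq_bigr => i _ /=.
by rewrite muniM muni_mwiden rmorphXn /= muni_ord_max mul_polyC.
Qed.

Lemma muni_inj n : injective (@muni n k).
Proof.
(* A left inverse of [muni]: include the coefficients in the larger ring and evaluate at the last
   variable. *)
pose psi (P : {poly {mpoly k[n]}}) : {mpoly k[n.+1]} :=
  (map_poly (@mwiden n k) P).['X_ord_max].
have psi_add P Q : psi (P + Q) = psi P + psi Q.
  by rewrite /psi rmorphD hornerD.
apply: (can_inj (g := psi)) => q; rewrite muniE.
rewrite (big_morph psi psi_add (id1 := 0));
  last by rewrite /psi rmorph0 horner0.
rewrite [RHS]mpolyE; apply: eq_bigr => m _.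
rewrite /psi -mul_mpolyC -!mul_polyC !(rmorphM, rmorphXn) /= map_polyX.
rewrite !map_polyC /= !hornerE mwidenC mul_mpolyC.
rewrite mwidenX mpolyXn -scalerAl -mpolyXD; congr (_ *: 'X_[_]).
apply/mnmP => i; rewrite mnmDE mulmnE mnm1E.
have [-> | neq_i] := eqVneq i ord_max.
  by rewrite mnmwiden_ordmax mul1n.
have lt_i : (i < n)%N by rewrite ltn_neqAle -ltnS ltn_ord andbT.
rewrite mul0n addn0.
have ->: i = widen_ord (leqnSn n) (Ordinal lt_i) by apply: val_inj.
by rewrite mnmwiden_widen mnmE.
Qed.

Lemma mpoly0_gcd_domain : gcd_domain {mpoly k[0]}.
Proof.
move=> x y; have unitP (z : {mpoly k[0]}) : z != 0 -> divides z 1.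
  have ->: z = (z@_0)%:MP.
    by apply/mpolyP=> m; rewrite mcoeffC nvar0_mnmE eqxx mulr1.
  rewrite mpolyC_eq0 => nz_z; exists ((z@_0)^-1)%:MP.
  by rewrite -mpolyCM mulVf.
have [-> | nz_x] := eqVneq x 0; last first.
  exists x; split=> [z _ | s t tx]; last by apply: tx; left.
  by rewrite -[z]mulr1; apply/divides_mull/unitP.
exists y; split=> [z [-> | ->] | s t ty]; last by apply: ty; right.
  exact: divides0.
exact: divides_refl.
Qed.

Lemma gcd_domain_bij (D E : idomainType) (phi : D -> E) :
  injective phi -> (forall y, exists x, phi x = y) ->
  {morph phi : x y / x * y} -> gcd_domain E -> gcd_domain D.
Proof.
move=> phi_inj phi_surj phiM gcdE.
have phi_div x y : divides x y <-> divides (phi x) (phi y).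
  split=> [[z ->] | [z]]; first by rewrite phiM; exists (phi z).
  by have [w <-] := phi_surj z; rewrite -phiM => /phi_inj ->; exists w.
move=> x y; have [e [e_xy xy_e]] := gcdE (phi x) (phi y).
have [d dE] := phi_surj e; exists d; split=> [z zxy | s t t_xy].
  by apply/phi_div; rewrite dE; apply: e_xy; case: zxy => ->; [left | right].
apply/phi_div; rewrite phiM dE; apply: xy_e => z zxy.
by case: zxy => ->; rewrite -phiM; apply/phi_div/t_xy; [left | right].
Qed.

Lemma mpoly_gcd_domain n : gcd_domain {mpoly k[n]}.
Proof.
elim: n => [|n IHn]; first exact: mpoly0_gcd_domain.
apply: (@gcd_domain_bij _ _ (@muni n k)); first exact: muni_inj.
- exact: muni_surj.
- exact: muniM.
- exact: poly_gcd_domain.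
Qed.

End MpolyGcd.

(** * Extending an action to the fraction field *)

Section FractionMap.

Local Notation repr := generic_quotient.repr.

Variable D : idomainType.

Lemma tofrac_inj : injective (@tofrac D).
Proof. by move=> x y /eqP; rewrite tofrac_eq => /eqP. Qed.

Lemma frac_repr (x : {fraction D}) :
  x = tofrac (\n_(repr x)) / tofrac (\d_(repr x)).
Proof.
have nz_d : tofrac (\d_(repr x)) != 0 by rewrite tofrac_eq0 denom_ratioP.
apply: (mulIf nz_d); rewrite divfK // -{1}[x]generic_quotient.reprK.
unlock FracField.tofrac; rewrite -[LHS]FracField.pi_mul.
apply/generic_quotient.eqmodP; rewrite /= FracField.equivfE /FracField.mulf /=.
by rewrite !numden_Ratio ?mulf_neq0 ?oner_neq0 ?denom_ratioP // !mulr1 mulrC.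
Qed.

Lemma fraction_split (x : {fraction D}) :
  exists u v, v != 0 /\ x = tofrac u / tofrac v.
Proof.
exists (\n_(repr x)), (\d_(repr x)); split; first exact: denom_ratioP.
exact: frac_repr.
Qed.

Variables (phi : {rmorphism D -> D}) (phi_inj : injective phi).

Let phi_neq0 v : v != 0 -> tofrac (phi v) != 0.
Proof. by move=> nz_v; rewrite tofrac_eq0 -(rmorph0 phi) (inj_eq phi_inj). Qed.

(** Injectivity is carried as an argument so that the ring morphism structure, which needs [phi] to
    preserve nonzero denominators, can be attached to [frac_map] itself. *)
Definition frac_map of injective phi := fun x : {fraction D} =>
  tofrac (phi (\n_(repr x))) / tofrac (phi (\d_(repr x))).

Lemma frac_map_div u v : v != 0 ->
  frac_map phi_inj (tofrac u / tofrac v) = tofrac (phi u) / tofrac (phi v).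
Proof.
move=> nz_v; set x := _ / _; apply/eqP; rewrite eq_sym /frac_map.
have nz_d := denom_ratioP (repr x).
rewrite eqr_div ?phi_neq0 // -!rmorphM tofrac_eq; apply/eqP; congr (phi _).
apply: tofrac_inj; rewrite !rmorphM; apply/eqP.
by rewrite -eqr_div ?tofrac_eq0 // -frac_repr.
Qed.

Lemma frac_map_tofrac u : frac_map phi_inj (tofrac u) = tofrac (phi u).
Proof.
by rewrite -[X in frac_map _ X]divr1 -tofrac1 frac_map_div ?oner_neq0 //
  rmorph1 tofrac1 divr1.
Qed.

Lemma frac_map_is_zmod_morphism : zmod_morphism (frac_map phi_inj).
Proof.
move=> x y; have [a [b [nz_b ->]]] := fraction_split x.
have [c [d [nz_d ->]]] := fraction_split y.
have [nz_b1 nz_d1] := (phi_neq0 nz_b, phi_neq0 nz_d).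
rewrite -mulNr addf_div ?tofrac_eq0 // -rmorphN -!rmorphM -rmorphD.
rewrite !frac_map_div ?mulf_neq0 // -mulNr addf_div //.
by rewrite !(rmorphD, rmorphM, rmorphN).
Qed.

Lemma frac_map_is_monoid_morphism : monoid_morphism (frac_map phi_inj).
Proof.
split=> [|x y]; first by rewrite -tofrac1 frac_map_tofrac rmorph1.
have [a [b [nz_b ->]]] := fraction_split x.
have [c [d [nz_d ->]]] := fraction_split y.
rewrite mulf_div -!rmorphM !frac_map_div ?mulf_neq0 //.
by rewrite mulf_div !rmorphM.
Qed.

HB.instance Definition _ := GRing.isZmodMorphism.Build
  {fraction D} {fraction D} (frac_map phi_inj) frac_map_is_zmod_morphism.
HB.instance Definition _ := GRing.isMonoidMorphism.Build
  {fraction D} {fraction D} (frac_map phi_inj) frac_map_is_monoid_morphism.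

End FractionMap.

Section ActionOnFractions.

Variables (D : idomainType) (gT : finGroupType) (G : {group gT}).
Variable act : gT -> {rmorphism D -> D}.
Hypothesis actM : {in G &, forall g h x, act (g * h)%g x = act g (act h x)}.
Hypothesis act_inj : forall g, injective (act g).
Implicit Types (x y : {fraction D}).

Definition frac_act g : {rmorphism {fraction D} -> {fraction D}} :=
  frac_map (@act_inj g).

Lemma frac_act_tofrac g u : frac_act g (tofrac u) = tofrac (act g u).
Proof. exact: frac_map_tofrac. Qed.

Lemma frac_act_div g u v : v != 0 ->
  frac_act g (tofrac u / tofrac v) = tofrac (act g u) / tofrac (act g v).
Proof. exact: frac_map_div. Qed.

Lemma act_eq0 g u : (act g u == 0) = (u == 0).
Proof. by rewrite -{1}(rmorph0 (act g)) (inj_eq (@act_inj g)). Qed.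

Lemma act1 u : act 1%g u = u.
Proof. by apply: (@act_inj 1%g); rewrite -actM ?group1 // mulg1. Qed.

Lemma frac_actM g h x : g \in G -> h \in G ->
  frac_act (g * h)%g x = frac_act g (frac_act h x).
Proof.
move=> Gg Gh; have [u [v [nz_v ->]]] := fraction_split x.
by rewrite !frac_act_div ?act_eq0 // !actM.
Qed.

Lemma frac_act1 x : frac_act 1%g x = x.
Proof.
have [u [v [nz_v ->]]] := fraction_split x.
by rewrite frac_act_div // !act1.
Qed.

(* A fixed fraction [u / v] acquires an invariant denominator when it is
   expanded by the conjugates of [v]. *)
Lemma in_frac_fixed (N : {group gT}) (B : {pred D}) x :
    N \subset G -> (forall u, u \in B <-> {in N, forall g, act g u = u}) ->
  in_frac B x <-> {in N, forall g, frac_act g x = x}.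
Proof.
move=> sNG memB; split=> [[u [v [/memB Bu /memB Bv nz_v ->]]] g Ng | fix_x].
  by rewrite frac_act_div // Bu // Bv.
have [u [v [nz_v xE]]] := fraction_split x.
pose w := \prod_(g in N) act g v.
pose w1 := \prod_(g in N | g != 1%g) act g v.
have wE : w = v * w1 by rewrite /w (bigD1 1%g) //= act1.
have nz_w : w != 0 by apply/prodf_neq0 => g _; rewrite act_eq0.
have fix_w : {in N, forall g, act g w = w}.
  move=> g Ng; rewrite rmorph_prod [RHS](reindex_inj (mulgI g)) /=.
  apply: eq_big => [h | h Nh]; first by rewrite groupMl.
  by rewrite actM ?(subsetP sNG).
have xw : tofrac (u * w1) = x * tofrac w.
  by rewrite xE wE !rmorphM /= mulrA divfK // tofrac_eq0.
exists (u * w1), w; split=> //; [|exact/memB|]; last first.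
  by rewrite xw mulfK ?tofrac_eq0.
apply/memB => g Ng; apply: tofrac_inj.
by rewrite -frac_act_tofrac xw rmorphM /= fix_x // frac_act_tofrac fix_w.
Qed.

End ActionOnFractions.

(** * The different of a cyclic extension of degree p *)

Section CyclicExtension.

Variables (D : idomainType) (gT : finGroupType) (G H : {group gT}).
Variable act : gT -> {rmorphism D -> D}.
Hypothesis actM : {in G &, forall g h x, act (g * h)%g x = act g (act h x)}.
Hypothesis act_inj : forall g, injective (act g).
Variables R A : {pred D}.
Hypothesis memR : forall u, u \in R <-> {in G, forall g, act g u = u}.
Hypothesis memA : forall u, u \in A <-> {in H, forall h, act h u = u}.
Hypothesis nHG : (H <| G)%g.
Variables (p : nat) (s : gT).
Hypotheses (p_prime : prime p) (Gs : s \in G) (Hsp : (s ^+ p)%g \in H).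
Hypothesis cosetG : forall g, g \in G ->
  exists j : 'I_p, exists2 h, h \in H & g = (s ^+ j * h)%g.

Local Notation L := {fraction D}.
Local Notation K := (in_frac R).
Local Notation F := (in_frac A).
Local Notation fact := (frac_act act_inj).
Implicit Types x y : L.

Let psi i : {rmorphism L -> L} := fact (s ^+ i)%g.

Let sHG : H \subset G. Proof. by case/andP: nHG. Qed.

Let Gsi i : (s ^+ i)%g \in G. Proof. exact: groupX. Qed.

Let KP x : K x <-> {in G, forall g, fact g x = x}.
Proof. exact: (in_frac_fixed actM act_inj x (subxx G) memR). Qed.

Let FP x : F x <-> {in H, forall h, fact h x = x}.
Proof. exact: (in_frac_fixed actM act_inj x sHG memA). Qed.

Lemma in_frac_sub x : K x -> F x.
Proof. by move/KP=> Kx; apply/FP => h Hh; rewrite Kx // (subsetP sHG). Qed.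

Lemma in_fracM x y : F x -> F y -> F (x * y).
Proof.
by move=> /FP Fx /FP Fy; apply/FP => h Hh; rewrite rmorphM /= Fx ?Fy.
Qed.

Lemma in_frac_expr x m : F x -> F (x ^+ m).
Proof. by move=> /FP Fx; apply/FP => h Hh; rewrite rmorphXn /= Fx. Qed.

Lemma in_frac_sum (I : Type) (r : seq I) (P : pred I) (f : I -> L) :
  (forall i, P i -> F (f i)) -> F (\sum_(i <- r | P i) f i).
Proof.
move=> Ff; apply/FP => h Hh; rewrite rmorph_sum; apply: eq_bigr => i /Ff/FP.
by apply.
Qed.

Lemma in_frac_act g x : g \in G -> F x -> F (fact g x).
Proof.
move=> Gg /FP Fx; apply/FP => h Hh; have Gh := subsetP sHG h Hh.
rewrite -(frac_actM actM) // conjgC (frac_actM actM) ?groupJ //; last first.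
by rewrite Fx // memJ_norm // (subsetP (normal_norm nHG)).
Qed.

Lemma in_frac_tofrac u : u \in A <-> F (tofrac u).
Proof.
split=> [/memA Au | /FP Fu].
  by apply/FP => h Hh; rewrite frac_act_tofrac Au.
by apply/memA => h Hh; apply: tofrac_inj; rewrite -(frac_act_tofrac act_inj) Fu.
Qed.

Lemma in_frac_tofracR u : u \in R <-> K (tofrac u).
Proof.
split=> [/memR Au | /KP Fu].
  by apply/KP => h Hh; rewrite frac_act_tofrac Au.
by apply/memR => h Hh; apply: tofrac_inj; rewrite -(frac_act_tofrac act_inj) Fu.
Qed.

Let psiD i j x : psi (i + j) x = psi i (psi j x).
Proof. by rewrite /psi expgD (frac_actM actM). Qed.

Let psi0 x : psi 0%N x = x.
Proof. by rewrite /psi expg0 (frac_act1 actM). Qed.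

Let psip x : F x -> psi p x = x.
Proof. by move/FP; apply. Qed.

Let F_psi i x : F x -> F (psi i x).
Proof. exact: in_frac_act. Qed.

Lemma frac_act_coset g : g \in G ->
  exists j : 'I_p, forall x, F x -> fact g x = psi j x.
Proof.
move=> /cosetG[j [h Hh ->]]; exists j => x /FP Fx.
by rewrite (frac_actM actM) ?(subsetP sHG h) // Fx.
Qed.

Lemma in_frac_fixed_gen x : F x -> psi 1%N x = x -> K x.
Proof.
move=> Fx fix_x; apply/KP => g /frac_act_coset[j ->] //.
by elim: (j : nat) => [|i IHi] //; rewrite -addn1 psiD fix_x.
Qed.

(** The Galois-theoretic trace; [is_traceP] identifies it with the matrix trace on [F]. *)
Definition orbit_trace x : L := \sum_(i < p) psi i x.
Local Notation Tr := orbit_trace.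

Lemma orbit_trace_fixed x : F x -> K (Tr x).
Proof.
move=> Fx; apply: in_frac_fixed_gen.
  by apply: in_frac_sum => i _; apply: F_psi.
(* Both sides become the sum of [psi i x] over [i <= p], split off at the first or at the last term;
   the two end terms agree on [F]. *)
rewrite rmorph_sum /=; apply: (addrI (psi 0%N x)).
under eq_bigr do rewrite -psiD.
rewrite -(big_ord_recl p (fun i : 'I_p.+1 => psi i x)) big_ord_recr /=.
by rewrite psip // psi0 addrC.
Qed.

Lemma orbit_traceZ c x : K c -> Tr (c * x) = c * Tr x.
Proof.
move=> /KP Kc; rewrite [RHS]mulr_sumr; apply: eq_bigr => i _.
by rewrite rmorphM /= Kc.
Qed.

Lemma orbit_trace_sum (I : Type) (r : seq I) (P : pred I) (f : I -> L) :
  Tr (\sum_(i <- r | P i) f i) = \sum_(i <- r | P i) Tr (f i).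
Proof.
by rewrite exchange_big; apply: eq_bigr => i _; rewrite rmorph_sum.
Qed.

(** * The trace form on the powers of [a] *)

Variable a : D.
Hypotheses (Aa : a \in A) (Ra : a \notin R).
Let al : L := tofrac a.

Let Fal : F al. Proof. exact/in_frac_tofrac. Qed.

Let psi_al_neq m : (0 < m < p)%N -> psi m al != al.
Proof.
move=> /andP[m_gt0 lt_mp]; apply: contraNneq Ra => fix_m.
apply/in_frac_tofracR/in_frac_fixed_gen => //.
have p_gt0 := prime_gt0 p_prime.
(* [p] divides [1 + u * m], so if [s ^+ m] fixes [al], then so does [s], which would put [a] in
   [R]. *)
have [u _] := Bezoutr m p_gt0.
have /eqP-> : coprime m p.
  by rewrite coprime_sym prime_coprime // gtnNdvd.
move=> /dvdnP[v vE].
have fix_mul q l : psi q al = al -> psi (l * q) al = al.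
  by move=> fix_q; elim: l => [|l IHl]; rewrite ?psi0 // mulSn psiD IHl.
by rewrite -/al -[RHS](fix_mul p v (psip Fal)) -vE psiD fix_mul.
Qed.

Lemma psi_al_inj (i j : 'I_p) : psi i al = psi j al -> i = j.
Proof.
have lt_neq (q r : 'I_p) : (q < r)%N -> psi q al <> psi r al.
  move=> lt_qr; rewrite -(subnKC (ltnW lt_qr)) psiD => /(fmorph_inj (psi q)).
  move/esym/eqP; apply/negP/psi_al_neq.
  by rewrite subn_gt0 lt_qr (leq_ltn_trans (leq_subr _ _)).
move=> eq_ij; apply: val_inj; have [lt_ij|lt_ji|//] := ltngtP i j.
  by case: (lt_neq _ _ lt_ij).
by case: (lt_neq _ _ lt_ji).
Qed.

Let V : 'M[L]_p := \matrix_(i, j) psi i al ^+ j.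
Let W := invmx V.
Let i0 : 'I_p := Ordinal (prime_gt0 p_prime).

Let unitV : V \in unitmx.
Proof.
have ->: V = (Vandermonde p (\row_i psi i al))^T.
  by apply/matrixP => i j; rewrite !mxE.
rewrite unitmx_tr unitmxE det_Vandermonde unitfE.
apply/prodf_neq0 => i _; apply/prodf_neq0 => j lt_ij; rewrite !mxE subr_eq0.
by apply: contraTneq lt_ij => /psi_al_inj ->; rewrite ltnn.
Qed.

(** [g] permutes the rows of [V], hence the columns of its inverse [W]; index [i0] is the identity
    conjugate, which [g] sends to conjugate [t]. *)
Let frac_act_W g (t : 'I_p) j : g \in G -> fact g al = psi t al ->
  fact g (W j i0) = W j t.
Proof.
move=> Gg g_t.
have VW (q r : 'I_p) : \sum_(l < p) psi q al ^+ l * W l r = (q == r)%:R.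
  have := mulmxV unitV => /matrixP/(_ q r); rewrite !mxE => <-.
  by apply: eq_bigr => l _; rewrite mxE.
suffices: (V *m \col_l fact g (W l i0)) = V *m \col_l W l t.
  by move/(can_inj (mulKmx unitV))/matrixP/(_ j 0); rewrite !mxE.
apply/matrixP => q z; rewrite !mxE.
under eq_bigr do rewrite !mxE.
under [RHS]eq_bigr do rewrite !mxE.
rewrite VW.
(* Row [q] of [V] is the image under [g] of row [r], where [s ^+ r] acts on [F] as
   [g^-1 * s ^+ q]. *)
have Gq : (g^-1 * s ^+ q)%g \in G by rewrite groupM ?groupV.
have [r rE] := frac_act_coset Gq.
have qE : psi q al = fact g (psi r al).
  by rewrite -rE // -(frac_actM actM) // mulKVg.
under eq_bigr do rewrite qE -rmorphXn -rmorphM.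
rewrite -rmorph_sum VW rmorph_nat; congr (nat_of_bool _)%:R.
apply/eqP/eqP => [r0 | qt].
  by apply: psi_al_inj; rewrite qE r0 psi0 g_t.
apply: psi_al_inj; apply: (fmorph_inj (fact g)).
by rewrite psi0 -qE g_t qt.
Qed.

(* The dual of the power basis of [a] for the trace form, read off the inverse
   of the Vandermonde matrix of the conjugates of [a]. *)
Lemma trace_dual_basis : exists w : 'I_p -> L,
  [/\ forall j, F (w j),
      forall x, F x -> x = \sum_(j < p) Tr (w j * x) * tofrac a ^+ j,
      forall i j : 'I_p, Tr (w i * tofrac a ^+ j) = (i == j)%:R
    & forall x, F x -> \sum_(j < p) Tr (x * w j * tofrac a ^+ j) = Tr x].
Proof.
pose w j := W j i0; have psi_w (i j : 'I_p) : psi i (w j) = W j i.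
  by apply: frac_act_W => //; apply: Gsi.
have VW (q r : 'I_p) : \sum_(l < p) psi q al ^+ l * W l r = (q == r)%:R.
  have := mulmxV unitV => /matrixP/(_ q r); rewrite !mxE => <-.
  by apply: eq_bigr => l _; rewrite mxE.
have WV (q r : 'I_p) : \sum_(l < p) W q l * psi l al ^+ r = (q == r)%:R.
  have := mulVmx unitV => /matrixP/(_ q r); rewrite !mxE => <-.
  by apply: eq_bigr => l _; rewrite mxE.
exists w; split=> [j|x Fx|i j|x Fx].
- apply/FP => h Hh; apply: frac_act_W; first exact: (subsetP sHG).
  by rewrite psi0; apply/FP: h Hh.
- under eq_bigr => j _.
    rewrite mulr_suml.
    under eq_bigr => i _ do rewrite rmorphM /= psi_w -mulrA mulrC -mulrA.
    over.
  rewrite exchange_big /= (bigD1 i0) //= [X in _ + X]big1.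
    rewrite addr0 -mulr_sumr -[X in _ * X]/(\sum_(j < p) _ * W j i0).
    have := VW i0 i0; rewrite psi0 eqxx => ->.
    by rewrite mulr1 psi0.
  move=> i neq_i; rewrite -mulr_sumr; have := VW i0 i.
  by rewrite psi0 eq_sym (negbTE neq_i) => ->; rewrite mulr0.
- rewrite -WV; apply: eq_bigr => l _.
  by rewrite rmorphM rmorphXn /= psi_w.
rewrite exchange_big; apply: eq_bigr => i _ /=.
under eq_bigr do rewrite -mulrA !rmorphM rmorphXn /= psi_w [W _ _ * _]mulrC.
by rewrite -mulr_sumr VW eqxx mulr1.
Qed.

(** In the power basis of [a] the matrix [N] of multiplication by [y] has trace [Tr y]. Another
    basis may a priori have a different size [m], so the base change matrices are shown to be
    inverse on both sides: [C *m B = 1] by freeness of [e], [B *m C = 1] by the dual basis. *)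
Lemma is_traceP y t : F y -> is_trace K F y t <-> t = Tr y.
Proof.
move=> Fy; have [w [Fw dualE dual1 dual_tr]] := trace_dual_basis.
have Fa j : F (al ^+ j) by apply: in_frac_expr.
pose N : 'M[L]_p := \matrix_(i, j) Tr (w i * (y * al ^+ j)).
have trN : \tr N = Tr y.
  rewrite -dual_tr //; apply: eq_bigr => i _.
  by rewrite !mxE mulrA [w i * y]mulrC.
split=> [[m [e [M [[Fe free_e span_e] KM yE ->]]]] | ->]; last first.
  exists p, (fun i : 'I_p => al ^+ i), N; split=> //.
  - split=> // [c Kc c0 i | x Fx].
      have := congr1 (fun x => Tr (w i * x)) c0.
      rewrite mulr0 mulr_sumr orbit_trace_sum /=.
      under eq_bigr => j _ do rewrite mulrCA orbit_traceZ // dual1.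
      rewrite (bigD1 i) //= eqxx mulr1 big1 ?addr0 => [->|j neq_ji].
        by rewrite /orbit_trace big1 // => j _; rewrite rmorph0.
      by rewrite eq_sym (negbTE neq_ji) mulr0.
    exists (fun j => Tr (w j * x)); last exact: dualE.
    by move=> j; apply/orbit_trace_fixed/in_fracM.
  - by move=> i j; rewrite mxE; apply/orbit_trace_fixed/in_fracM => //;
      apply: in_fracM.
  move=> j; rewrite [LHS]dualE; last exact: in_fracM.
  by apply: eq_bigr => i _; rewrite mxE.
pose B : 'M[L]_(p, m) := \matrix_(j, l) Tr (w j * e l).
have /fin_all_exists2[c Kc cE] (i : 'I_p) := span_e _ (Fa i).
pose C : 'M[L]_(m, p) := \matrix_(l, i) c i l.
have BE l : e l = \sum_(j < p) B j l * al ^+ j.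
  by rewrite [LHS]dualE //; apply: eq_bigr => j _; rewrite mxE.
have KB j l : K (B j l) by rewrite mxE; apply/orbit_trace_fixed/in_fracM.
have CB1 : C *m B = 1%:M.
  apply/matrixP => i l; apply/eqP; rewrite -subr_eq0; apply/eqP; move: i.
  apply: free_e => [i | ].
    apply/KP => g Gg; rewrite rmorphB !mxE rmorph_nat rmorph_sum; congr (_ - _).
    apply: eq_bigr => j _; rewrite rmorphM !mxE.
    by move/KP: (KB j l); rewrite mxE => -> //; move/KP: (Kc j i) => ->.
  under eq_bigr do rewrite mulrBl.
  rewrite sumrB [X in _ - X](bigD1 l) //= [X in _ - (_ + X)]big1; last first.
    by move=> i neq_il; rewrite mxE (negbTE neq_il) mul0r.
  rewrite mxE eqxx mul1r addr0 (BE l).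
  apply/eqP; rewrite subr_eq0; apply/eqP.
  under eq_bigr do rewrite mxE mulr_suml.
  rewrite exchange_big; apply: eq_bigr => j _ /=.
  rewrite cE mulr_sumr; apply: eq_bigr => i _.
  by rewrite [C i j]mxE mulrAC mulrC mulrA.
have BC1 : B *m C = 1%:M.
  apply/matrixP => j i; rewrite !mxE -dual1 cE mulr_sumr orbit_trace_sum.
  apply: eq_bigr => l _; rewrite [C l i]mxE mulrCA orbit_traceZ //.
  by rewrite mxE mulrC.
have NB : N *m B = B *m M.
  apply/matrixP => j l; rewrite !mxE.
  transitivity (Tr (w j * (y * e l))).
    rewrite BE !mulr_sumr orbit_trace_sum; apply: eq_bigr => i _.
    rewrite [N j i]mxE mulrC -orbit_traceZ //; congr (Tr _).
    by ring.
  rewrite yE mulr_sumr orbit_trace_sum; apply: eq_bigr => i _.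
  by rewrite mulrCA orbit_traceZ // mxE mulrC.
by rewrite -trN -[M]mul1mx -CB1 -mulmxA -NB mulmxA mxtrace_mulC mulmxA BC1
  mul1mx.
Qed.

(** Otherwise the trace would vanish on all of [F], whereas the dual basis element of index 0 has
    trace 1. *)
Lemma orbit_trace_neq0 : exists j : 'I_p, Tr (al ^+ j) <> 0.
Proof.
apply: NNPP => nex; have [w [Fw dualE dual1 _]] := trace_dual_basis.
have Tr0 x : F x -> Tr x = 0.
  move=> Fx; rewrite (dualE x Fx) orbit_trace_sum big1 // => j _.
  rewrite orbit_traceZ; last by apply/orbit_trace_fixed/in_fracM.
  have [->|/eqP nz] := eqVneq (Tr (al ^+ j)) 0; first by rewrite mulr0.
  by case: nex; exists j.
have /eqP := dual1 i0 i0; rewrite Tr0 ?eqxx 1?eq_sym ?oner_eq0 //.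
by apply: in_fracM => //; apply: in_frac_expr.
Qed.

Definition integral x := exists2 b, b \in A & x = tofrac b.

Lemma integralP x : integral x <-> F x /\ exists b, x = tofrac b.
Proof.
split=> [[b Ab ->] | [Fx [b xb]]]; last first.
  by exists b => //; apply/in_frac_tofrac; rewrite -xb.
by split; [apply/in_frac_tofrac | exists b].
Qed.

Lemma common_denominator m (c : 'I_m -> L) : (forall i, K (c i)) ->
  exists r, [/\ r \in R, r != 0 &
    forall i, exists2 u, u \in R & tofrac r * c i = tofrac u].
Proof.
move=> Kc; have split i : exists2 r, r \in R /\ r != 0 &
    exists2 u, u \in R & tofrac r * c i = tofrac u.
  have [u [v [Ru Rv nz_v ->]]] := Kc i; exists v => //; exists u => //.
  by rewrite mulrCA divff ?tofrac_eq0 // mulr1.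
have /fin_all_exists2[r Rr rc] := split.
exists (\prod_i r i); split=> [||i].
- apply/memR => g Gg; rewrite rmorph_prod; apply: eq_bigr => i _.
  by have [/memR-> ] := Rr i.
- by apply/prodf_neq0 => i _; case: (Rr i).
have [u Ru uE] := rc i.
exists ((\prod_(j | j != i) r j) * u).
  apply/memR => g Gg; rewrite rmorphM rmorph_prod /=.
  have /memR-> // := Ru; congr (_ * _); apply: eq_bigr => j _.
  by have [/memR-> ] := Rr j.
by rewrite (bigD1 i) //= mulrC rmorphM mulrA [c i * _]mulrC uE -rmorphM mulrC.
Qed.

(** Nondegeneracy of the trace form: [y] is the combination of the dual basis with coefficients
    [f (a ^+ j)]. *)
Lemma functional_trace (f : D -> D) :
    {in A, forall b, f b \in R} ->
    {in A &, forall b c, f (b + c) = f b + f c} ->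
    {in R & A, forall r b, f (r * b) = r * f b} ->
  exists2 y, F y & forall b, b \in A -> tofrac (f b) = Tr (y * tofrac b).
Proof.
move=> fR fD fZ; have [w [Fw dualE dual1 _]] := trace_dual_basis.
have Aj j : a ^+ j \in A by apply/in_frac_tofrac; rewrite rmorphXn;
  apply: in_frac_expr.
have Fj j : F (tofrac (f (a ^+ j))) by apply/in_frac_sub/in_frac_tofracR/fR.
pose y := \sum_(j < p) tofrac (f (a ^+ j)) * w j.
exists y => [|b Ab]; first by apply: in_frac_sum => j _; apply: in_fracM.
have Fb : F (tofrac b) by apply/in_frac_tofrac.
have Kc j : K (Tr (w j * tofrac b)) by apply/orbit_trace_fixed/in_fracM.
(* [f] is linear over [R] only, so the coordinates of [b] in the power basis are first cleared of
   denominators. *)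
have [r [Rr nz_r]] := common_denominator Kc.
move=> /fin_all_exists2[u Ru uE].
have RA b1 : b1 \in R -> b1 \in A.
  by move=> /in_frac_tofracR/in_frac_sub/in_frac_tofrac.
have rbE : r * b = \sum_(j < p) u j * a ^+ j.
  apply: tofrac_inj; rewrite rmorphM /= (dualE _ Fb) mulr_sumr rmorph_sum.
  by apply: eq_bigr => j _ /=; rewrite mulrA uE rmorphM rmorphXn.
have f_sum (I : seq 'I_p) :
    \sum_(j <- I) u j * a ^+ j \in A /\
    f (\sum_(j <- I) u j * a ^+ j) = \sum_(j <- I) u j * f (a ^+ j).
  have A0 : 0 \in A by apply/in_frac_tofrac/FP => h Hh; rewrite !rmorph0.
  have R0 : 0 \in R by apply/in_frac_tofracR/KP => h Hh; rewrite !rmorph0.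
  elim: I => [|j I [IH1 IH2]]; first by rewrite !big_nil -[X in f X](mul0r 0)
    fZ // mul0r.
  have Auj : u j * a ^+ j \in A.
    apply/in_frac_tofrac; rewrite rmorphM; apply: in_fracM;
      last exact/in_frac_tofrac.
    exact/in_frac_tofrac/RA.
  rewrite !big_cons fD // fZ // IH2; split=> //.
  apply/memA => h Hh; rewrite rmorphD /=.
  by have /memA-> := Auj => //; have /memA-> := IH1.
apply: (@mulfI _ (tofrac r)); first by rewrite tofrac_eq0.
rewrite -rmorphM -fZ // rbE (f_sum _).2 rmorph_sum mulr_suml orbit_trace_sum
  mulr_sumr.
apply: eq_bigr => j _; rewrite rmorphM /= -uE -[_ * w j * _]mulrA.
rewrite [Tr (tofrac (f _) * _)]orbit_traceZ; first by ring.
exact/in_frac_tofracR/fR.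
Qed.

(** * Integral multiples of the inverse different *)

Lemma inverse_differentP y : inverse_different R A y <->
  F y /\ forall b, b \in A -> exists2 r, r \in R & Tr (y * tofrac b) = tofrac r.
Proof.
split=> -[Fy tr]; split=> // b Ab; have [r Rr rE] := tr b Ab; exists r => //.
  by apply/esym/is_traceP => //; apply: in_fracM => //; apply/in_frac_tofrac.
by apply/is_traceP => //; apply: in_fracM => //; apply/in_frac_tofrac.
Qed.

Let A_closed : [/\ {in A &, forall b c, b + c \in A},
  {in A &, forall b c, b - c \in A} & {in A &, forall b c, b * c \in A}].
Proof.
split=> b c /memA Ab /memA Ac; apply/memA => h Hh.
- by rewrite rmorphD /= Ab // Ac.
- by rewrite rmorphB /= Ab // Ac.
- by rewrite rmorphM /= Ab // Ac.
Qed.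

Let A_act g b : g \in G -> b \in A -> act g b \in A.
Proof.
move=> Gg /in_frac_tofrac/(in_frac_act Gg); rewrite frac_act_tofrac.
by move/in_frac_tofrac.
Qed.

Let sigma i b := act (s ^+ i)%g b.

Let psi_tofrac i b : psi i (tofrac b) = tofrac (sigma i b).
Proof. exact: frac_act_tofrac. Qed.

Let sigma_p b : b \in A -> sigma p b = b.
Proof. by move/memA; apply. Qed.

Let sigmaD i j b : sigma (i + j) b = sigma i (sigma j b).
Proof. by rewrite /sigma expgD actM. Qed.

(** Expanding the factor of index [i] writes the sum as [b i] times the sum for the shorter list,
    minus the latter with [c] replaced by [c * sigma i (b i)]. For the empty list the sum is the
    trace of [y * c]. *)
Lemma inverse_different_twisted_prod y (r : seq nat) (b : nat -> D) c :
    inverse_different R A y -> (forall i, b i \in A) -> c \in A ->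
  integral (\sum_(j < p) psi j (y * tofrac c) *
     \prod_(i <- r) (tofrac (b i) - psi j (psi i (tofrac (b i))))).
Proof.
move=> /inverse_differentP[Fy tr_y] Ab; have [_ AB AM] := A_closed.
elim: r c => [|i r IHr] c Ac.
  under eq_bigr do rewrite big_nil mulr1.
  have [u Ru uE] := tr_y c Ac; exists u => //.
  by apply/in_frac_tofrac/in_frac_sub/in_frac_tofracR.
have [u Au uE] := IHr c Ac.
have [v Av vE] := IHr (c * sigma i (b i)) (AM _ _ Ac (A_act (Gsi i) (Ab i))).
exists (b i * u - v); first by apply: AB => //; apply: AM.
rewrite rmorphB rmorphM /= -uE -vE mulr_sumr -sumrB; apply: eq_bigr => j _.
rewrite big_cons [tofrac (c * _)]rmorphM /= -psi_tofrac !rmorphM /=; ring.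
Qed.

(** With [c = 1] and all indices from 1 to [p - 1], only the term [j = 0] of the twisted sum
    survives. *)
Lemma inverse_different_prod y (b : nat -> D) :
    inverse_different R A y -> (forall i, b i \in A) ->
  integral (y * \prod_(i <- iota 1 p.-1) tofrac (b i - sigma i (b i))).
Proof.
move=> y_inv Ab; have A1 : 1 \in A by apply/memA => h _; rewrite rmorph1.
have [u Au uE] := inverse_different_twisted_prod (iota 1 p.-1) y_inv Ab A1.
exists u; rewrite // -uE (bigD1 i0) //= [X in _ + X]big1 => [|j neq_j].
  rewrite addr0 psi0 rmorph1 mulr1; congr (_ * _); apply: eq_bigr => i _.
  by rewrite psi0 psi_tofrac rmorphB.
(* For [j > 0] the factor of index [p - j] is zero. *)
have j_gt0 : (0 < j)%N by rewrite lt0n -[0%N]/(val i0) val_eqE.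
have jp : (p - j)%N \in iota 1 p.-1.
  rewrite mem_iota subn_gt0 ltn_ord add1n prednK ?prime_gt0 //.
  by rewrite ltn_subrL j_gt0 prime_gt0.
rewrite (big_rem _ jp) /= -psiD subnKC ?(ltnW (ltn_ord j)) //.
by rewrite psip ?subrr ?mul0r ?mulr0 //; apply/in_frac_tofrac.
Qed.

Let delta b := sigma 1%N b - b.

Let deltaM b c : c \in R -> delta (c * b) = c * delta b.
Proof. by move/memR=> Rc; rewrite /delta /sigma rmorphM /= Rc // mulrBr. Qed.

(** * The gcd of the differences [sigma 1 b - b] *)

Variable norm : D -> nat.
Hypothesis normP : forall b c : D, c != 0 -> divides b c ->
  (norm b <= norm c)%N /\ (norm b = norm c -> divides c b).
Hypothesis gcdD : gcd_domain D.
Hypothesis act_unit : forall g b u, g \in G -> divides u 1 ->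
  act g b = u * b -> act g b = b.

(** [G] acts on [F] through powers of [s], which commute with [s]. *)
Let delta_act g b : g \in G -> b \in A -> act g (delta b) = delta (act g b).
Proof.
move=> Gg Ab; have Fb : F (tofrac b) by apply/in_frac_tofrac.
have [j jE] := frac_act_coset Gg.
apply: tofrac_inj; rewrite /delta !rmorphB /=.
rewrite -psi_tofrac -!(frac_act_tofrac act_inj g) -psi_tofrac !jE //.
  by rewrite -!psiD addnC.
exact: F_psi.
Qed.

Let divides_act g b c : divides b c -> divides (act g b) (act g c).
Proof. by move=> [z ->]; rewrite rmorphM; exists (act g z). Qed.

Lemma delta_neq0 : delta a != 0.
Proof.
rewrite subr_eq0; apply: contraNneq Ra => sa.
apply/in_frac_tofracR/in_frac_fixed_gen; first exact: Fal.
by rewrite psi_tofrac sa.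
Qed.

Lemma gcd_delta : exists d, [/\ d != 0, d \in R,
   forall b, b \in A -> exists2 q, q \in A & delta b = d * q &
   forall t u, (forall b, b \in A -> divides t (u * delta b)) ->
     divides t (u * d)].
Proof.
pose X u := exists2 b, b \in A & u = delta b.
have Xa : X (delta a) by exists a.
have [d nz_d [d_X X_d]] := gcd_of_pred normP gcdD Xa delta_neq0.
(* [g] permutes the differences, so it preserves their gcd up to a unit, and [act_unit] makes that
   unit trivial. *)
have d_act g : g \in G -> divides (act g d) d.
  move=> Gg; rewrite -[d in divides _ d]mul1r; apply: X_d => _ [b Ab ->].
  rewrite mul1r; have Gg' : g^-1%g \in G by rewrite groupV.
  have ->: delta b = act g (delta (act g^-1%g b)).
    by rewrite -delta_act // -actM // mulgV (act1 actM act_inj).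
  apply/divides_act/d_X; exists (act g^-1%g b) => //; exact: A_act.
have Rd : d \in R.
  apply/memR => g Gg; have [|u u1 gd] := divides_antisym nz_d _ (d_act g Gg).
    rewrite -[d in divides d _](act1 actM act_inj) -(mulgV g) actM ?groupV //.
    by apply/divides_act/d_act; rewrite groupV.
  exact: act_unit gd.
exists d; split=> // [b Ab | t u t_u]; last by apply: X_d => _ [b Ab ->];
  exact: t_u.
have [|q qE] := d_X (delta b); first by exists b.
exists q; last by rewrite mulrC.
have Adb : delta b \in A by have [_ AB _] := A_closed; apply: AB => //;
  apply: A_act.
apply/memA => h Hh; apply: (mulIf nz_d); rewrite -qE.
have Gh := subsetP sHG h Hh; move/memR: Rd => /(_ h Gh) {1}<-.
by rewrite -rmorphM /= -qE; move/memA: Adb; apply.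
Qed.

Let delta_sumn (I : Type) (r : seq I) (m : I -> nat) (f : I -> D) :
  delta (\sum_(i <- r) f i *+ m i) = \sum_(i <- r) delta (f i) *+ m i.
Proof.
rewrite /delta /sigma rmorph_sum -sumrB; apply: eq_bigr => i _.
by rewrite rmorphMn mulrnBl.
Qed.

(** With [sigma 1 = 1 + delta], this is the polynomial identity for [((1 + X)^m - 1) / X]. *)
Let sum_sigma m b :
  \sum_(i < m) sigma i b = \sum_(j < m) iter j delta b *+ 'C(m, j.+1).
Proof.
elim: m => [|m IHm]; first by rewrite !big_ord0.
have sigma0 : sigma 0%N b = b by rewrite /sigma expg0 (act1 actM act_inj).
have sigma1 c : sigma 1%N c = c + delta c by rewrite addrC subrK.
have ->: \sum_(i < m.+1) sigma i b = b + sigma 1%N (\sum_(i < m) sigma i b).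
  rewrite big_ord_recl sigma0 /sigma rmorph_sum; congr (_ + _).
  by apply: eq_bigr => i _; rewrite -[LHS]/(sigma (1 + i)%N b) sigmaD.
rewrite sigma1 IHm delta_sumn.
under [RHS]eq_bigr do rewrite binS mulrnDr.
rewrite big_split /= [in RHS]big_ord_recr /= bin_small // mulr0n addr0.
by rewrite [in RHS]big_ord_recl /= bin0 mulr1n addrCA.
Qed.

Hypothesis pcharD : p \in [pchar D].

(** In characteristic [p] only the last binomial coefficient survives. *)
Let sum_sigma_p b : \sum_(i < p) sigma i b = iter p.-1 delta b.
Proof.
have p_gt0 := prime_gt0 p_prime.
rewrite sum_sigma -[in LHS](prednK p_gt0) big_ord_recr /= prednK // binn mulr1n.
rewrite big1 ?add0r // => i _.
have /dvdnP[q ->] : (p %| 'C(p, i.+1))%N.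
  by apply: prime_dvd_bin => //=; rewrite -[p in (_ < p)%N](prednK p_gt0) ltnS.
by rewrite mulrnA mulrn_pchar.
Qed.

(** * The different as a power of [d] *)

Section Ramification.

Variable d : D.
Hypotheses (nz_d : d != 0) (Rd : d \in R).
Hypothesis delta_d : forall b, b \in A -> exists2 q, q \in A & delta b = d * q.
Hypothesis d_delta : forall t u,
  (forall b, b \in A -> divides t (u * delta b)) -> divides t (u * d).

Let Rdm m : d ^+ m \in R.
Proof. by apply/memR => g Gg; rewrite rmorphXn /=; move/memR: Rd => ->. Qed.

Let R_sub b : b \in R -> b \in A.
Proof. by move/memR => Rb; apply/memA => h /(subsetP sHG)/Rb. Qed.

Lemma iter_delta_div m b : b \in A ->
  exists2 q, q \in A & iter m delta b = d ^+ m * q.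
Proof.
move=> Ab; elim: m => [|m [q Aq IHm]]; first by exists b; rewrite ?expr0 ?mul1r.
have [r Ar rE] := delta_d Aq; exists r => //.
by rewrite iterS IHm deltaM // rE mulrA -exprSr.
Qed.

Lemma orbit_trace_div b : b \in A ->
  exists2 q, q \in R & Tr (tofrac b) = tofrac (d ^+ p.-1 * q).
Proof.
move=> Ab; have [q Aq qE] := iter_delta_div p.-1 Ab.
have TrE : Tr (tofrac b) = tofrac (d ^+ p.-1 * q).
  rewrite -qE -sum_sigma_p rmorph_sum; apply: eq_bigr => i _.
  exact: psi_tofrac.
exists q => //; have /orbit_trace_fixed : F (tofrac b) by apply/in_frac_tofrac.
rewrite TrE => /in_frac_tofracR/memR fix_q; apply/memR => g Gg.
apply: (@mulfI _ (d ^+ p.-1)); first by rewrite expf_neq0.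
by rewrite -[RHS](fix_q g Gg) rmorphM /=; move/memR: (Rdm p.-1) => ->.
Qed.

(** For [z = v / t] the hypothesis says that [t] divides every [v * delta b]; the scale-invariant
    gcd property then gives that [t] divides [v * d]. *)
Let denominator_gcd z :
    (forall b, b \in A -> exists u, z * tofrac (delta b) = tofrac u) ->
  exists u, z * tofrac d = tofrac u.
Proof.
move=> z_delta; have [v [t [nz_t zE]]] := fraction_split z.
have nz_t' : tofrac t != 0 by rewrite tofrac_eq0.
have [|u uE] := @d_delta t v.
  move=> b Ab; have [u uE] := z_delta b Ab; exists u.
  by apply: tofrac_inj; rewrite !rmorphM /= -uE zE mulrAC divfK.
exists u; apply: (mulIf nz_t').
by rewrite zE -rmorphM -uE rmorphM mulrAC divfK.
Qed.

Let denominator_gcd_sigma z i : (0 < i < p)%N ->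
    (forall b, b \in A -> exists u, z * tofrac (b - sigma i b) = tofrac u) ->
  exists u, z * tofrac d = tofrac u.
Proof.
move=> /andP[i_gt0 lt_ip] z_i.
have [l _] := Bezoutr i (prime_gt0 p_prime).
have /eqP-> : coprime i p by rewrite coprime_sym prime_coprime // gtnNdvd.
(* [p] divides [1 + l * i], so [s ^+ (l * i)] acts on [A] as [s^-1]. *)
move=> /dvdnP[v vE]; apply: denominator_gcd => b Ab.
(* The difference for [m * i] telescopes into differences for [i]. *)
have z_li m c : c \in A ->
    exists u, z * tofrac (c - sigma (m * i) c) = tofrac u.
  move=> Ac; elim: m => [|m [u uE]].
    by exists 0; rewrite mul0n /sigma expg0 (act1 actM act_inj) subrr rmorph0
      mulr0.
  have [w wE] := z_i _ (A_act (Gsi (m * i)) Ac); exists (u + w).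
  rewrite [RHS]rmorphD /= -uE -wE -mulrDr -rmorphD mulSn sigmaD.
  by congr (_ * tofrac _); ring.
(* As [sigma (l * i)] undoes [sigma 1] on [A], this difference is [delta b]. *)
have [|u uE] := z_li l (sigma 1%N b); first exact: A_act.
exists u; rewrite -uE -sigmaD addnC vE; congr (_ * tofrac (_ - _)).
by elim: v {vE} => [|v IHv]; rewrite ?mulSn ?sigmaD -?IHv ?sigma_p //
  /sigma expg0 (act1 actM act_inj).
Qed.

(** The factors are replaced by [d] one at a time: since the indices are distinct, one [b i] can
    vary while the others stay fixed. *)
Let denominator_prod (r : seq nat) z :
    uniq r -> {in r, forall i, (0 < i < p)%N} ->
    (forall b : nat -> D, (forall i, b i \in A) -> exists u,
       z * \prod_(i <- r) tofrac (b i - sigma i (b i)) = tofrac u) ->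
  exists u, z * tofrac (d ^+ size r) = tofrac u.
Proof.
elim: r z => [|i r IHr] z /=.
  move=> _ _ /(_ (fun=> a) (fun=> Aa))[u].
  by rewrite big_nil rmorph1 => uE; exists u.
move=> /andP[r'i uniq_r] lt_r z_prod; rewrite exprSr rmorphM mulrA.
rewrite /= in IHr *; apply: (denominator_gcd_sigma (lt_r i _));
  first exact: mem_head.
move=> c Ac; rewrite mulrAC; apply: IHr => // [j rj|b Ab].
  by apply: lt_r; rewrite inE rj orbT.
have [|u uE] := z_prod (fun j => if j == i then c else b j).
  by move=> j; case: ifP.
exists u; rewrite -uE big_cons eqxx mulrA; congr (_ * _).
rewrite !big_seq; apply: eq_bigr => j rj; case: eqP => // ji.
by rewrite ji (negbTE r'i) in rj.
Qed.

Lemma inverse_different_denominator y : inverse_different R A y ->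
  integral (y * tofrac (d ^+ p.-1)).
Proof.
move=> y_inv; have Fy : F y by case: y_inv.
apply/integralP; split.
  apply: in_fracM => //; apply/in_frac_tofrac; exact: R_sub.
rewrite -[p.-1](size_iota 1); apply: denominator_prod; first exact: iota_uniq.
  move=> i; rewrite mem_iota => /andP[-> lt_i] /=.
  by rewrite -(prednK (prime_gt0 p_prime)) -add1n.
by move=> b Ab; have [u _ ->] := inverse_different_prod y_inv Ab; exists u.
Qed.

Lemma inverse_different_inv : inverse_different R A (tofrac (d ^+ p.-1))^-1.
Proof.
have Kd : K (tofrac (d ^+ p.-1)) by apply/in_frac_tofracR.
have Kd' : K (tofrac (d ^+ p.-1))^-1.
  by apply/KP => g Gg; rewrite fmorphV /=; move/KP: Kd => ->.
apply/inverse_differentP; split=> [|b Ab]; first exact: in_frac_sub.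
have [q Rq qE] := orbit_trace_div Ab; exists q => //.
rewrite orbit_traceZ // qE rmorphM mulKf // tofrac_eq0 expf_neq0 //.
Qed.

(** The power of [d] lies in the different, so [Delta] divides it; its inverse lies in the inverse
    different, so it divides [Delta]. *)
Lemma different_generator Delta : generates_different R A Delta ->
  exists2 u, divides u 1 & Delta = u * d ^+ p.-1.
Proof.
move=> [ADelta Delta_gen].
have [v Av vE] : exists2 b, b \in A & tofrac (d ^+ p.-1) = tofrac (Delta * b).
  apply/Delta_gen; split; first by apply/in_frac_tofrac/R_sub.
  by move=> y /inverse_different_denominator; rewrite mulrC.
have [_ Delta_diff] : dedekind_different R A (tofrac Delta).
  apply/Delta_gen; exists 1; last by rewrite mulr1.
  by apply/memA => h _; rewrite rmorph1.
have [u Au uE] := Delta_diff _ inverse_different_inv.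
have nz_dp : tofrac (d ^+ p.-1) != 0 by rewrite tofrac_eq0 expf_neq0.
have DeltaE : Delta = u * d ^+ p.-1.
  by apply: tofrac_inj; rewrite rmorphM /= -uE divfK.
exists u => //; exists v; apply: (mulIf (expf_neq0 p.-1 nz_d)).
by rewrite mul1r -mulrA -DeltaE mulrC; apply: tofrac_inj.
Qed.

Lemma direct_summand_delta : direct_summand R A ->
  exists2 b, b \in A & delta b = d.
Proof.
move=> [f [fR fD fZ f_id]].
have [y Fy fE] := functional_trace fR fD fZ.
have y_inv : inverse_different R A y.
  by apply/inverse_differentP; split=> // b Ab; exists (f b); rewrite ?fR // fE.
have [th Ath thE] := inverse_different_denominator y_inv.
have R1 : 1 \in R by apply/memR => g _; rewrite rmorph1.
(* The left side is the trace of [y * d ^+ p.-1], and [Tr y = f 1 = 1]. *)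
have tr_th : iter p.-1 delta th = d ^+ p.-1.
  apply: tofrac_inj; rewrite -sum_sigma_p rmorph_sum /=.
  under eq_bigr do rewrite -psi_tofrac -thE.
  rewrite -[LHS]/(Tr _) mulrC orbit_traceZ; last exact/in_frac_tofracR.
  by rewrite -[y]mulr1 -[in Tr _]tofrac1 -fE ?R_sub // f_id // tofrac1 mulr1.
have [b Ab bE] := iter_delta_div p.-2 Ath; exists b => //.
have p2 : p.-1 = p.-2.+1 by case: p (prime_gt1 p_prime) => [|[]].
apply: (@mulfI _ (d ^+ p.-2)); first by rewrite expf_neq0.
by rewrite -deltaM // -bE -exprSr -p2 -tr_th p2.
Qed.

End Ramification.

Definition conj_trace b : D := \sum_(i < p) act (s ^+ i)%g b.

Let orbit_trace_tofrac b : Tr (tofrac b) = tofrac (conj_trace b).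
Proof. by rewrite rmorph_sum; apply: eq_bigr => i _; apply: psi_tofrac. Qed.

Lemma is_trace_tofrac b t : b \in A ->
  is_trace K F (tofrac b) t <-> t = tofrac (conj_trace b).
Proof.
by move=> /in_frac_tofrac Fb; rewrite -orbit_trace_tofrac; apply: is_traceP.
Qed.

Lemma conj_trace_neq0 : exists j : 'I_p, conj_trace (a ^+ j) != 0.
Proof.
have [j /eqP nz_tr] := orbit_trace_neq0; exists j; move: nz_tr.
by rewrite -rmorphXn orbit_trace_tofrac tofrac_eq0.
Qed.

Theorem ramification : exists d,
  [/\ d != 0 /\ d \in R,
      forall b, b \in A -> exists2 q, q \in A & act s b - b = d * q,
      forall b, b \in A -> exists2 q, q \in R & conj_trace b = d ^+ p.-1 * q,
      forall Delta, generates_different R A Delta ->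
        exists2 u, divides u 1 & Delta = u * d ^+ p.-1
    & direct_summand R A -> exists2 b, b \in A & act s b - b = d].
Proof.
have [d [nz_d Rd delta_d d_delta]] := gcd_delta; exists d; split=> //.
- move=> b Ab; have [q Rq] := orbit_trace_div nz_d Rd delta_d Ab.
  by rewrite orbit_trace_tofrac => /tofrac_inj; exists q.
- exact: different_generator.
- exact: direct_summand_delta.
Qed.

End CyclicExtension.

(** * Linear actions on polynomials *)

Section LinearAction.

Variables (k : fieldType) (n : nat).
Local Notation S := {mpoly k[n]}.
Implicit Types (q : S).

(** The norm condition behind the existence of infinite gcds: when the sizes agree, the cofactor is
    a nonzero constant. *)
Lemma msize_dividesP q1 q2 : q2 != 0 -> divides q1 q2 ->
  (msize q1 <= msize q2)%N /\ (msize q1 = msize q2 -> divides q2 q1).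
Proof.
move=> nz_q2 [q q2E]; move: nz_q2; rewrite q2E mulf_eq0 negb_or => /andP[nz_q
  nz_q1].
have sz_q : (0 < msize q)%N by rewrite lt0n msize_poly_eq0.
rewrite msizeM //; split=> [|eq_sz];
  first by rewrite -(prednK sz_q) addSn /= leq_addl.
have /eqP/msize_poly1P[c nz_c ->] : msize q = 1%N.
  move: eq_sz; rewrite -[in RHS](prednK sz_q) addSn /= -[LHS]add0n.
  by move/addIn => q0; rewrite -(prednK sz_q) -q0.
by exists (c^-1)%:MP; rewrite mulrA -mpolyCM mulVf // mul1r.
Qed.

Lemma divides1_const q : divides q 1 -> exists2 c, c != 0 & q = c%:MP.
Proof.
move=> q1; have [le_q _] := msize_dividesP (oner_neq0 _) q1.
have qE := msize1_polyC (leq_trans le_q (eq_leq (@msize1 n k))).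
exists (q@_0) => //; apply/eqP => q0; move: q1.
by rewrite qE q0 mpolyC0 => -[z /eqP]; rewrite mulr0 oner_eq0.
Qed.

Lemma mdegreeM q1 q2 : q1 != 0 -> q2 != 0 ->
  mdegree (q1 * q2) = (mdegree q1 + mdegree q2)%N.
Proof.
move=> nz1 nz2; rewrite /mdegree msizeM //.
have := msize_poly_eq0 q1; have := msize_poly_eq0 q2.
rewrite (negbTE nz1) (negbTE nz2).
by case: (msize q1) => // i; case: (msize q2) => // j; rewrite addSn addnS.
Qed.

Lemma mdegreeX q m : q != 0 -> mdegree (q ^+ m) = (m * mdegree q)%N.
Proof.
move=> nz_q; elim: m => [|m IHm]; first by rewrite expr0 mul0n /mdegree msize1.
by rewrite exprS mdegreeM ?expf_neq0 // IHm mulSn.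
Qed.

Lemma mdegree_divides q1 q2 : q2 != 0 -> divides q1 q2 ->
  (mdegree q1 <= mdegree q2)%N.
Proof.
by move=> nz_q2 /(msize_dividesP nz_q2)[le_q _];
  rewrite /mdegree -!subn1 leq_sub2r.
Qed.

Lemma mdegree_eq0 q : mdegree q = 0%N -> q = (q@_0)%:MP.
Proof. by move=> q0; rewrite /mdegree in q0; apply: msize1_polyC;
  rewrite -subn_eq0 subn1; apply/eqP. Qed.

Lemma mdegreeC (c : k) : mdegree (c%:MP : S) = 0%N.
Proof. by rewrite /mdegree msizeC; case: eqP. Qed.

Lemma mdegree_dhomog q d : q != 0 -> q \is d.-homog -> mdegree q = d.
Proof. by move=> nz_q hom_q; apply: dhomog_uniq nz_q (dhomog_msize hom_q)
  hom_q. Qed.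

Lemma mpoly_rmorphism_eq (f g : {rmorphism S -> S}) :
    (forall c : k, f c%:MP = g c%:MP) -> (forall i, f 'X_i = g 'X_i) -> f =1 g.
Proof.
move=> fgC fgX; elim/mpolyind => [|c m q _ _ IHq]; first by rewrite !rmorph0.
rewrite !rmorphD IHq -mul_mpolyC !rmorphM fgC; congr (_ * _ + _).
rewrite mpolyXE_id !rmorph_prod; apply: eq_bigr => i _.
by rewrite !rmorphXn /= fgX.
Qed.

Lemma homogeneous_component_neq0 q : q != 0 ->
  exists2 d, (d <= mdegree q)%N & pihomog mdeg d q != 0.
Proof.
move=> nz_q; apply: NNPP => nex; case/eqP: nz_q.
rewrite (pihomog_partitionE (leqnn (msize q))) big1 // => i _.
apply/eqP; apply: contraT => nz_i; case: nex; exists (i : nat) => //.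
by rewrite -ltnS /mdegree prednK // (leq_ltn_trans _ (ltn_ord i)).
Qed.

Section LinearSubstitution.

Variable lin : n.-tuple S.
Hypothesis lin_hom : forall i, tnth lin i \is 1.-homog.

Lemma comp_linear_dhomog d q : q \is d.-homog -> (q \mPo lin) \is d.-homog.
Proof.
move=> /dhomogP hom_q; rewrite comp_mpolyEX big_seq.
apply: rpred_sum => m m_q; have /= <- := hom_q m m_q; apply: dhomogZ.
rewrite comp_mpolyX mdegE.
elim/big_rec2: _ => [|i e u _ IH]; first exact: dhomog1.
by apply: dhomogM => //; have := dhomogMn (m i) (lin_hom i); rewrite mul1n.
Qed.

Lemma comp_linear_pihomog d q :
  pihomog mdeg d q \mPo lin = pihomog mdeg d (q \mPo lin).
Proof.
have comp_pi e : pihomog mdeg e q \mPo lin \is e.-homog.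
  by apply: comp_linear_dhomog; apply: pihomogP.
have qE : q \mPo lin = \sum_(e < msize q) (pihomog mdeg e q \mPo lin).
  by rewrite [in LHS](pihomog_partitionE (leqnn (msize q))) (raddf_sum
    (comp_mpoly lin)).
rewrite qE (raddf_sum (pihomog mdeg d)).
have [lt_d | le_d] := ltnP d (msize q).
  rewrite (bigD1 (Ordinal lt_d)) //= (pihomog_dE (comp_pi d)) big1 ?addr0 // =>
    e neq_e.
  by rewrite (pihomog_ne0 _ (comp_pi e)).
rewrite big1 => [|e _]; last first.
  by rewrite /= (pihomog_ne0 _ (comp_pi e)) // ltn_eqF // (leq_trans (ltn_ord
    e)).
rewrite pihomogE big_seq_cond big_pred0 ?comp_mpoly0 // => m.
apply/andP => -[/msize_mdeg_lt lt_m /eqP eq_m].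
by rewrite eq_m ltnNge le_d in lt_m.
Qed.

End LinearSubstitution.

Variables (gT : finGroupType) (G : {group gT}) (rG : mx_representation k G n).

(* [rG] is only meaningful on [G]; elements outside [G] act trivially here, so
   that every element acts injectively. *)
Definition group_lin g : n.-tuple S :=
  [tuple \sum_(j < n) rG (if g \in G then g else 1%g) j i *: 'X_j | i < n].

Definition group_act g : {rmorphism S -> S} := comp_mpoly (group_lin g).

Lemma group_actE g q : g \in G -> group_act g q = poly_act rG g q.
Proof. by move=> Gg; rewrite /= /group_lin Gg. Qed.

Lemma group_actX g i : g \in G ->
  group_act g 'X_i = \sum_(j < n) rG g j i *: 'X_j.
Proof. by move=> Gg; rewrite /= comp_mpolyXU -tnth_nth tnth_mktuple Gg. Qed.

Lemma group_actC g c : group_act g c%:MP = c%:MP.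
Proof. exact: comp_mpolyC. Qed.

Lemma group_actM :
  {in G &, forall g h q, group_act (g * h)%g q = group_act g (group_act h q)}.
Proof.
move=> g h Gg Gh q; rewrite -[RHS]/((group_act g \o group_act h) q).
apply: mpoly_rmorphism_eq => [c | i]; first by rewrite /= !comp_mpolyC.
rewrite group_actX ?groupM //= group_actX // raddf_sum /=.
under [RHS]eq_bigr => j _.
  rewrite comp_mpolyZ -[_ \mPo _]/(group_act g _) group_actX // scaler_sumr.
  over.
rewrite exchange_big; apply: eq_bigr => l _ /=.
under eq_bigr do rewrite scalerA mulrC.
by rewrite -scaler_suml repr_mxM // mxE.
Qed.

Lemma group_act1 q : group_act 1%g q = q.
Proof.
rewrite -[RHS]/(idfun q); apply: mpoly_rmorphism_eq => [c | i].
  by rewrite group_actC.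
rewrite group_actX // repr_mx1 (bigD1 i) //= mxE eqxx scale1r big1 ?addr0 //.
by move=> j neq_ji; rewrite mxE (negbTE neq_ji) scale0r.
Qed.

Lemma group_act_inj g : injective (group_act g).
Proof.
have [Gg | G'g] := boolP (g \in G); last first.
  suff gE q : group_act g q = group_act 1%g q by move=> x y;
    rewrite !gE !group_act1.
  by rewrite /= /group_lin (negbTE G'g) group1.
apply: (can_inj (g := group_act g^-1%g)) => q.
by rewrite -group_actM ?groupV // mulVg group_act1.
Qed.

Lemma group_lin_homog g i : tnth (group_lin g) i \is 1.-homog.
Proof.
rewrite tnth_mktuple; apply: rpred_sum => j _; apply: dhomogZ.
by rewrite dhomogX /= mdeg1.
Qed.

Lemma group_act_dhomog g d q : q \is d.-homog -> group_act g q \is d.-homog.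
Proof. by apply: comp_linear_dhomog => i; apply: group_lin_homog. Qed.

Lemma group_act_pihomog g d q :
  group_act g (pihomog mdeg d q) = pihomog mdeg d (group_act g q).
Proof. by apply: comp_linear_pihomog => i; apply: group_lin_homog. Qed.

Lemma invariantsP (N : {group gT}) q : N \subset G ->
  q \in invariants rG N <-> {in N, forall g, group_act g q = q}.
Proof.
move=> sNG; split=> [/forall_inP Nq g Ng | Nq].
  by rewrite group_actE ?(subsetP sNG) //; apply/eqP/Nq.
by apply/forall_inP => g Ng; rewrite -group_actE ?(subsetP sNG) // Nq.
Qed.

(** The unit is a scalar [c] with [c ^+ #|G| = 1]. As [#|G| = p ^ e], Frobenius gives
    [(c - 1) ^+ (p ^ e) = 0], so [c = 1]. *)
Lemma group_act_unit p g q u : p \in [pchar k] -> (p.-group G)%g -> g \in G ->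
  divides u 1 -> group_act g q = u * q -> group_act g q = q.
Proof.
move=> char_k pG Gg /divides1_const[c nz_c ->] gq.
have [-> | nz_q] := eqVneq q 0; first by rewrite rmorph0.
have gm m : group_act (g ^+ m)%g q = (c ^+ m)%:MP * q.
  elim: m => [|m IHm]; first by rewrite expg0 group_act1 expr0 mul1r.
  rewrite expgS group_actM ?groupX // IHm rmorphM group_actC gq.
  by rewrite exprSr mpolyCM mulrA.
have [e eG] := p_natP pG.
have cp1 : c ^+ (p ^ e) = 1.
  have := gm (p ^ e)%N; rewrite -eG.
  have -> : (g ^+ #|G|)%g = 1%g by apply/eqP; rewrite -order_dvdn order_dvdG.
  rewrite group_act1 -[LHS]mul1r => /(mulIf nz_q)/esym/eqP.
  by rewrite -mpolyC1 mpolyC_eq => /eqP.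
have char_pe : [pchar k].-nat (p ^ e)%N.
  by rewrite pnatX pnatE ?char_k // (pcharf_prime char_k).
have /eqP : (c - 1) ^+ (p ^ e) = 0.
  by rewrite exprDn_pchar // exprNn_pchar // cp1 expr1n subrr.
by rewrite expf_eq0 subr_eq0 gq => /andP[_ /eqP->]; rewrite mul1r.
Qed.

End LinearAction.

(** * The last step of the series and the three equivalent conditions *)

Lemma penultimate_cosets (p : nat) (k : fieldType) (n : nat)
    (gT : finGroupType) (G G' : {group gT}) (rG : mx_representation k G n) :
    prime p -> penultimate_subgroup rG p G' ->
  (G' <| G)%g /\ exists s, [/\ s \in G, (s ^+ p)%g \in G' &
    forall g, g \in G ->
      exists j : 'I_p, exists2 h, h \in G' & g = (s ^+ j * h)%g].
Proof.
move=> p_prime [[m [H [[_ HG step] HmG']]] _].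
have [[_] ] := step m (ltnSn m); rewrite HG HmG' => nG'G _ isoZ [t].
rewrite !inE => /andP[_ Gt] quoE _; split=> //; exists t.
have nG't g : g \in G -> g \in 'N(G')%g by apply/subsetP/normal_norm.
have ord_t : #[coset G' t]%g = p.
  by rewrite orderE -quoE (card_isog isoZ) card_Zp ?prime_gt0.
split=> // [|g Gg].
  by apply: coset_idr; rewrite ?groupX ?nG't // morphX ?nG't //= -ord_t
    expg_order.
have: coset G' g \in <[coset G' t]>%g by rewrite -quoE mem_quotient.
move=> /cyclePmin[i]; rewrite ord_t => lt_ip gE.
exists (Ordinal lt_ip), (t ^- i * g)%g; last by rewrite mulKVg.
apply: coset_idr; first by rewrite groupM ?groupV ?groupX ?nG't.
by rewrite morphM ?groupV ?groupX ?nG't //= morphV ?groupX ?nG't //= morphX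
  ?nG't //= gE mulVg.
Qed.

Theorem proposition3p9 (p : nat) (k : fieldType) (n : nat)
    (gT : finGroupType) (G : {group gT}) (rG : mx_representation k G n)
    (p_prime : prime p) (char_k : p \in [pchar k])
    (rG_faithful : mx_faithful rG) (pG : (p.-group G)%g)
    (G_gen : transvection_generated rG G) (G_tri : triangular rG)
    (G' : {group gT}) (hG' : penultimate_subgroup rG p G')
    (Delta : {mpoly k[n]}) (Delta_homog : Delta \is homog mdeg)
    (Delta_gen :
       generates_different (invariants rG G) (invariants rG G') Delta)
    (a : {mpoly k[n]})
    (ha : smallest_homog_outside (invariants rG G) (invariants rG G') a) :
  let R := invariants rG G in
  let A := invariants rG G' in
  let K := in_frac R in
  let F := in_frac A in
  [<-> mdegree Delta = (p.-1 * mdegree a)%N;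
       exists (lambda : k) (t : {fraction {mpoly k[n]}}),
         [/\ lambda != 0, is_trace K F (tofrac (a ^+ p.-1)) t
           & tofrac Delta = tofrac lambda%:MP * t];
       direct_summand R A].
Proof.
move=> R A K F; have [Aa Ra a_hom a_min] := ha.
have [nG'G [s [Gs Gsp cosetG]]] := penultimate_cosets p_prime hG'.
have sG'G := normal_sub nG'G.
have memR q : q \in R <-> {in G, forall g, group_act rG g q = q}.
  by apply: invariantsP.
have memA q : q \in A <-> {in G', forall g, group_act rG g q = q}.
  by apply: invariantsP.
have actM := @group_actM k n gT G rG;
  have act_inj := @group_act_inj k n gT G rG.
have char_S : p \in [pchar {mpoly k[n]}] by rewrite pchar_lalg.
have act_unit g q u : g \in G -> divides u 1 ->
    group_act rG g q = u * q -> group_act rG g q = q.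
  exact: group_act_unit char_k pG.
have [d [[nz_d Rd] delta_d trace_d Delta_d summand_d]] :=
  ramification actM act_inj memR memA nG'G p_prime Gs Gsp cosetG Aa Ra
    (@msize_dividesP k n) (@mpoly_gcd_domain k n) act_unit char_S.
have nz_delta : group_act rG s a - a != 0 := delta_neq0 actM act_inj memR memA
  nG'G Gs cosetG Aa Ra.
have tr_a := conj_trace_neq0 actM act_inj memR memA nG'G p_prime Gs Gsp cosetG
  Aa Ra.
have traceP b t := @is_trace_tofrac _ _ _ _ _ actM act_inj _ _ memR memA nG'G _
  _ p_prime Gs Gsp cosetG a Aa Ra b t.
have [u u1 DeltaE] := Delta_d _ Delta_gen.
have [c nz_c uE] := divides1_const u1.
pose tr := conj_trace (group_act rG) p s.
have a_dhom : a \is (mdegree a).-homog by rewrite -homog_msize.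
(* Constants are invariant, so [a] is not constant. *)
have a_gt0 : (0 < mdegree a)%N.
  rewrite lt0n; apply: contraNneq Ra => /mdegree_eq0 ->.
  by apply/memR => g _; rewrite group_actC.
have le_da : (mdegree d <= mdegree a)%N.
  have [q _ qE] := delta_d a Aa.
  have delta_hom : group_act rG s a - a \is (mdegree a).-homog.
    by rewrite rpredB // group_act_dhomog.
  rewrite -(mdegree_dhomog nz_delta delta_hom); apply: mdegree_divides => //.
  by exists q; rewrite mulrC.
have AX j : a ^+ j \in A.
  by apply/memA => h Hh; rewrite rmorphXn /=; move/memA: Aa => ->.
have degDelta : mdegree Delta = (p.-1 * mdegree d)%N.
  by rewrite DeltaE uE mdegreeM ?mpolyC_eq0 ?expf_neq0 // mdegreeC add0n
    mdegreeX.
have p1_gt0 : (0 < p.-1)%N by rewrite -subn1 subn_gt0 prime_gt1.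
tfae.
(* Here [deg d = deg a]. Some [tr (a ^+ j)] with [j < p] is a nonzero multiple of [d ^+ p.-1], and
   comparing degrees forces [j = p - 1] with a constant cofactor [q]. *)
- rewrite degDelta => /eqP; rewrite eqn_pmul2l // => /eqP deg_d.
  have tr_hom j : tr (a ^+ j) \is (mdegree a * j).-homog.
    by apply: rpred_sum => i _; apply/group_act_dhomog/dhomogMn.
  have [j nz_tr] := tr_a; have [q _ qE] := trace_d _ (AX j).
  have nz_q : q != 0.
    by apply: contraNneq nz_tr => q0; rewrite qE q0 mulr0.
  have := mdegree_dhomog nz_tr (tr_hom j).
  rewrite qE mdegreeM ?expf_neq0 // mdegreeX // deg_d => deg_eq.
  have jE : j = p.-1 :> nat.
    apply/eqP; rewrite eqn_leq -ltnS prednK ?prime_gt0 // ltn_ord /=.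
    by rewrite -(leq_pmul2l a_gt0) -deg_eq mulnC leq_addr.
  have /mdegree_eq0 q_const : mdegree q = 0%N.
    apply/eqP; rewrite -(eqn_add2l (p.-1 * mdegree a)) addn0 deg_eq jE mulnC.
    by [].
  move: (q@_0) q_const => q0 q_const.
  have nz_q0 : q0 != 0 by apply: contraNneq nz_q => q00;
    rewrite q_const q00 mpolyC0.
  exists (c / q0), (tofrac (tr (a ^+ p.-1))); split.
  + by rewrite mulf_neq0 ?invr_eq0.
  + exact/traceP.
  rewrite -rmorphM /= -jE /tr qE q_const mulrCA -mpolyCM divfK //.
  by rewrite mulrC DeltaE uE.
- move=> [lambda [t [nz_lambda /(traceP _ _ (AX _)) -> DeltaT]]].
  have [q Rq qE] := trace_d _ (AX p.-1).
  have nz_dp : d ^+ p.-1 != 0 by rewrite expf_neq0.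
  (* Compare the two expressions [c * d ^+ p.-1] and [lambda * q * d ^+ p.-1] of [Delta]. *)
  have q_inv : q * (lambda / c)%:MP = 1.
    apply: (mulIf nz_dp); rewrite mul1r; apply: (@mulfI _ c%:MP).
      by rewrite mpolyC_eq0.
    rewrite -uE -DeltaE; apply: tofrac_inj; rewrite DeltaT qE -rmorphM /=;
      congr (tofrac _).
    rewrite uE mpolyCM; have: (c%:MP : {mpoly k[n]}) * (c^-1)%:MP = 1.
      by rewrite -mpolyCM divff.
    by move=> cc1; rewrite -[RHS]mul1r -cc1; ring.
  have AaX b : b \in A -> a ^+ p.-1 * b \in A.
    by move=> /memA Ab; apply/memA => h Hh; rewrite rmorphM /= Ab //;
      move/memA: (AX p.-1) => ->.
  (* The implication makes the choice total: the quotient by [d ^+ p.-1] on [A], and an arbitrary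
     value elsewhere. *)
  have ex b : exists r, (b \in A) ==>
      (r \in R) && (tr (a ^+ p.-1 * b) == d ^+ p.-1 * r).
    have [Ab | _] := boolP (b \in A); last by exists 0.
    by have [r Rr rE] := trace_d _ (AaX b Ab); exists r; rewrite Rr /tr rE eqxx.
  pose f b := xchoose (ex b); have fP b : b \in A ->
      f b \in R /\ tr (a ^+ p.-1 * b) = d ^+ p.-1 * f b.
    by move=> Ab; have /implyP/(_ Ab)/andP[-> /eqP] := xchooseP (ex b).
  have trD b1 b2 : tr (b1 + b2) = tr b1 + tr b2.
    by rewrite /tr /conj_trace -big_split; apply: eq_bigr => i _;
      rewrite /= rmorphD.
  have trZ r b : r \in R -> tr (r * b) = r * tr b.
    move=> /memR Rr; rewrite /tr /conj_trace mulr_sumr; apply: eq_bigr => i _.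
    by rewrite /= rmorphM /= Rr // groupX.
  (* On [R], [f] is multiplication by [q]; the scalar is the inverse of [q]. *)
  exists (fun b => (lambda / c)%:MP * f b);
    split=> [b Ab|b1 b2 Ab1 Ab2|r b Rr Ab|r Rr].
  + by apply/memR => g Gg; rewrite rmorphM group_actC;
      have [/memR-> //] := fP b Ab.
  + rewrite -mulrDr; congr (_ * _); apply: (mulfI nz_dp); rewrite mulrDr.
    have Ab12 : b1 + b2 \in A.
      by apply/memA => h Hh; rewrite rmorphD /= ((memA b1).1 Ab1) // ((memA
        b2).1 Ab2).
    rewrite -(fP _ Ab1).2 -(fP _ Ab2).2 -(fP _ Ab12).2 mulrDr; exact: trD.
  + rewrite mulrCA; congr (_ * _); apply: (mulfI nz_dp).
    have Arb : r * b \in A.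
      apply/memA => h Hh; rewrite rmorphM /=; move/memA: Ab => -> //.
      by move/memR: Rr => -> //; apply: (subsetP sG'G).
    by rewrite mulrCA -(fP _ Ab).2 -(fP _ Arb).2 -trZ // mulrCA.
  have Ar : r \in A.
    by apply/memA => h Hh; move/memR: Rr => -> //; apply: (subsetP sG'G).
  rewrite (_ : f r = r * q); first by rewrite mulrCA [_ * q]mulrC q_inv mulr1.
  apply: (mulfI nz_dp); rewrite -(fP _ Ar).2 mulrC trZ // mulrCA; congr (_ * _).
  exact: qE.
move=> /summand_d[b Ab bE].
(* [d] is not known to be homogeneous, so a nonzero component of degree [e <= deg d] is used: the
   component of [b] in degree [e] is moved by [s], and minimality gives [deg a <= e]. *)
have [e le_ed nz_de] := homogeneous_component_neq0 nz_d.
pose be := pihomog mdeg e b.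
have deltaE : group_act rG s be - be = pihomog mdeg e d.
  by rewrite /be group_act_pihomog -bE (raddfB (pihomog mdeg e)).
have be_A : be \in A.
  by apply/memA => h Hh; rewrite /be group_act_pihomog; move/memA: Ab => ->.
have be_R : be \notin R.
  apply: contraNN nz_de => /memR Rbe.
  by rewrite -deltaE Rbe // subrr.
have nz_be : be != 0.
  by apply: contraNneq nz_de => be0; rewrite -deltaE be0 rmorph0 subrr.
have be_hom : be \is e.-homog by apply: pihomogP.
have le_ae := a_min be be_A be_R (homogE be_hom).
rewrite (mdegree_dhomog nz_be be_hom) in le_ae.
rewrite degDelta; congr (_ * _)%N; apply/eqP.
by rewrite eqn_leq le_da (leq_trans le_ae).
Qed.
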